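(* Let $p$ be a prime and let $G$ and $K$ be finitely presented (discrete) groups that have isomorphic pro-$p$ completions. Then $G$ is $p$-large if and only if $K$ is $p$-large.
   Context: For a prime $p$, a group is $p$-large if it contains a normal subgroup with index a power of $p$ that admits a surjective homomorphism onto a free non-abelian group. The isomorphism of pro-$p$ completions is not required to be induced by a homomorphism $G\to K$. *)

(* Defs.v *)
From HB Require Import structures.
From mathcomp Require Import all_boot.
From mathcomp Require Import all_classical topology.

Set Implicit Arguments.
Unset Strict Implicit.
Unset Printing Implicit Defensive.

Local Open Scope classical_set_scope.
Local Open Scope card_scope.
Local Open Scope quotient_scope.
Local Open Scope group_scope.

(* Between groups, a morphism of unitary magmas is a group homomorphism. *)
Notation "{ 'ghom' G -> H }" := (UMagmaMorphism.type G%type H%type)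
  (at level 0, G at level 98, H at level 99, format "{ 'ghom'  G  ->  H }")
  : type_scope.

Record normalSubgroup (G : groupType) := NormalSubgroup {
  ns_pred :> {pred G};
  ns_closed : group_closed ns_pred;
  ns_conj : forall x y : G, x \in ns_pred -> x ^ y \in ns_pred
}.

Section NormalSubgroup.
Variables (G : groupType) (N : normalSubgroup G).

Lemma ns1 : 1 \in N.
Proof. exact: (ns_closed N).1. Qed.

Lemma nsM x y : x \in N -> y \in N -> x * y \in N.
Proof. exact: group_closedM (ns_closed N) x y. Qed.

Lemma nsV x : x \in N -> x^-1 \in N.
Proof. exact: group_closedV (ns_closed N) x. Qed.

Definition subg_of : Type := {x : G | x \in N}.
HB.instance Definition _ := SubChoice.on subg_of.
HB.instance Definition _ := SubChoice_isSubGroup.Build G _ subg_of (ns_closed N).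

Definition coset_rel : rel G := fun x y => x^-1 * y \in N.

Lemma coset_rel_refl : reflexive coset_rel.
Proof. by move=> x; rewrite /coset_rel mulVg; exact: ns1. Qed.

Lemma coset_rel_sym : symmetric coset_rel.
Proof.
by move=> x y; apply/idP/idP => /nsV; rewrite /coset_rel invgM invgK.
Qed.

Lemma coset_rel_trans : transitive coset_rel.
Proof.
by move=> y x z xy yz; have := nsM xy yz; rewrite mulgA mulgK.
Qed.

Canonical coset_equiv :=
  EquivRel coset_rel coset_rel_refl coset_rel_sym coset_rel_trans.

Definition quotg : Type := {eq_quot coset_equiv}.
HB.instance Definition _ := Choice.on quotg.
HB.instance Definition _ := EqQuotient.on quotg.

Lemma quotgP (x y : G) : \pi_quotg x = \pi_quotg y <-> x^-1 * y \in N.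
Proof. by split=> [/eqquotP|h]; last exact/eqquotP. Qed.

Definition quotg_one : quotg := \pi_quotg 1.
Definition quotg_mul (x y : quotg) : quotg := \pi_quotg (repr x * repr y).
Definition quotg_inv (x : quotg) : quotg := \pi_quotg (repr x)^-1.

Lemma pi_quotgM (x y : G) :
  \pi_quotg (x * y) = quotg_mul (\pi_quotg x) (\pi_quotg y).
Proof.
have /quotgP hx : \pi_quotg x = \pi_quotg (repr (\pi_quotg x)) by rewrite reprK.
have /quotgP hy : \pi_quotg y = \pi_quotg (repr (\pi_quotg y)) by rewrite reprK.
apply/quotgP; have := nsM (ns_conj y hx) hy.
by rewrite /conjg invgM !mulgA mulgK.
Qed.

Lemma pi_quotgV (x : G) : \pi_quotg x^-1 = quotg_inv (\pi_quotg x).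
Proof.
have /quotgP hx : \pi_quotg x = \pi_quotg (repr (\pi_quotg x)) by rewrite reprK.
apply/quotgP; have := ns_conj x^-1 (nsV hx).
by rewrite /conjg invgM !invgK mulgK.
Qed.

Lemma quotg_mulA : associative quotg_mul.
Proof.
move=> x y z; rewrite -[x]reprK -[y]reprK -[z]reprK.
move: (repr x) (repr y) (repr z) => a b c.
by rewrite -(pi_quotgM b c) -(pi_quotgM a b) -!pi_quotgM mulgA.
Qed.

Lemma quotg_mul1 : left_id quotg_one quotg_mul.
Proof. by move=> x; rewrite -[x]reprK -pi_quotgM mul1g. Qed.

Lemma quotg_mulr1 : right_id quotg_one quotg_mul.
Proof. by move=> x; rewrite -[x]reprK -pi_quotgM mulg1. Qed.

Lemma quotg_mulV : left_inverse quotg_one quotg_inv quotg_mul.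
Proof. by move=> x; rewrite -[x]reprK -pi_quotgV -pi_quotgM mulVg. Qed.

Lemma quotg_mulrV : right_inverse quotg_one quotg_inv quotg_mul.
Proof. by move=> x; rewrite -[x]reprK -pi_quotgV -pi_quotgM mulgV. Qed.

HB.instance Definition _ := isGroup.Build quotg
  quotg_mulA quotg_mul1 quotg_mulr1 quotg_mulV quotg_mulrV.

HB.instance Definition _ := hasNbhs.Build quotg (@principal_filter quotg).
HB.instance Definition _ := Discrete_ofNbhs.Build quotg erefl.

End NormalSubgroup.

Definition ppower_index (p : nat) (G : groupType) (N : normalSubgroup G) :=
  exists k : nat, [set: quotg N] #= `I_(p ^ k)%N.

(* This is the canonical map G/N -> G/M only when N is contained in M (see
   quotg_projE); otherwise it depends on the choice of representatives. *)
Definition quotg_proj (G : groupType) (N M : normalSubgroup G) (x : quotg N) :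
  quotg M := \pi_(quotg M) (repr x).

Lemma quotg_projE (G : groupType) (N M : normalSubgroup G) (x : G) :
  {subset N <= M} -> quotg_proj M (\pi_(quotg N) x) = \pi_(quotg M) x.
Proof.
move=> NM; have /quotgP/NM hx : \pi_(quotg N) (repr (\pi_(quotg N) x)) = \pi x.
  by rewrite reprK.
exact/quotgP.
Qed.

Section ProPCompletion.
Variables (p : nat) (G : groupType).

Definition pindex : Type := {N : normalSubgroup G | ppower_index p N}.
HB.instance Definition _ := gen_eqMixin pindex.
HB.instance Definition _ := gen_choiceMixin pindex.

(* Each quotient is discrete, so this is the product topology of finite discrete
   groups; pro_completion below gets the induced topology of inverse limit. *)
Definition quotg_prod : Type := prod_topology (fun N : pindex => quotg (sval N)).
HB.instance Definition _ := Topological.on quotg_prod.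

Definition prod_mul (x y : quotg_prod) : quotg_prod := fun N => x N * y N.
Definition prod_inv (x : quotg_prod) : quotg_prod := fun N => (x N)^-1.
Definition prod_one : quotg_prod := fun=> 1.

Lemma prod_mulA : associative prod_mul.
Proof. by move=> x y z; apply/functional_extensionality_dep => N; exact: mulgA. Qed.
Lemma prod_mul1 : left_id prod_one prod_mul.
Proof. by move=> x; apply/functional_extensionality_dep => N; exact: mul1g. Qed.
Lemma prod_mulr1 : right_id prod_one prod_mul.
Proof. by move=> x; apply/functional_extensionality_dep => N; exact: mulg1. Qed.
Lemma prod_mulV : left_inverse prod_one prod_inv prod_mul.
Proof. by move=> x; apply/functional_extensionality_dep => N; exact: mulVg. Qed.
Lemma prod_mulrV : right_inverse prod_one prod_inv prod_mul.
Proof. by move=> x; apply/functional_extensionality_dep => N; exact: mulgV. Qed.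

HB.instance Definition _ := isGroup.Build quotg_prod
  prod_mulA prod_mul1 prod_mulr1 prod_mulV prod_mulrV.

Definition compatible : set quotg_prod := [set x | forall N M : pindex,
  {subset sval N <= sval M} -> quotg_proj (sval M) (x N) = x M].

Lemma compatible_closed : group_closed (mem compatible).
Proof.
split=> [|x y].
  by rewrite inE => N M NM; exact: quotg_projE.
rewrite !inE => cx cy N M NM.
change (quotg_proj (sval M) (x N / y N) = x M / y M).
rewrite -(cx N M NM) -(cy N M NM) -[x N]reprK -[y N]reprK.
move: (repr (x N)) (repr (y N)) => a b.
have piF (L : normalSubgroup G) :
    \pi_(quotg L) a / \pi_(quotg L) b = \pi_(quotg L) (a / b).
  by rewrite pi_quotgM pi_quotgV.
by rewrite piF !quotg_projE // piF.
Qed.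

Definition pro_completion : Type := set_type compatible.
HB.instance Definition _ := SubChoice.on pro_completion.
HB.instance Definition _ :=
  SubChoice_isSubGroup.Build quotg_prod _ pro_completion compatible_closed.
HB.instance Definition _ := Topological.copy pro_completion (set_type compatible).

End ProPCompletion.

(* Isomorphism of topological groups. *)
Definition pro_completion_iso (p : nat) (G K : groupType) : Prop :=
  exists (f : {ghom pro_completion p G -> pro_completion p K})
         (g : pro_completion p K -> pro_completion p G),
    [/\ cancel f g, cancel g f, continuous f & continuous g].

(* Universal property of a basis b of F. *)
Definition free_on (X : Type) (F : groupType) (b : X -> F) : Prop :=
  forall (H : groupType) (h : X -> H), exists f : {ghom F -> H},
    (forall x, f (b x) = h x) /\
    (forall f' : {ghom F -> H}, (forall x, f' (b x) = h x) -> f' =1 f).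

Definition free_group (F : groupType) : Prop :=
  exists (X : Type) (b : X -> F), free_on b.

Definition normal_closure (G : groupType) (R : set G) : set G :=
  [set x | forall N : normalSubgroup G, R `<=` [set y | y \in N] -> x \in N].

Definition finitely_presented (G : groupType) : Prop :=
  exists (n : nat) (F : groupType) (b : 'I_n -> F) (f : {ghom F -> G})
         (R : set F),
    [/\ free_on b, set_surj setT setT f, finite_set R &
        [set x | f x = 1] = normal_closure R].

Definition p_large (p : nat) (G : groupType) : Prop :=
  exists (N : normalSubgroup G) (F : groupType) (f : {ghom subg_of N -> F}),
    [/\ ppower_index p N, free_group F, (exists x y : F, x * y <> y * x) &
        set_surj setT setT f].

(* Main.v *)
Require Import Defs.
From mathcomp Require Import all_boot.
From HB Require Import structures.
From mathcomp Require Import all_algebra.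
From mathcomp Require fingroup perm cyclic pgroup.
From mathcomp Require Import all_classical topology.

(** By symmetry it is enough to show that [K] is [p]-large when [G] is. Let [N]
    be normal in [G] of [p]-power index with a surjection onto a free nonabelian
    group [F]. The isomorphism of completions makes [K] dense in the pro-[p]
    completion of [G], so that some normal subgroup [K0] of [K] of [p]-power
    index maps densely to the pro-[p] completion of [F]; an [approximation]
    records what is needed of this map. Open subgroups [V] of [F] thus give
    subgroups [H] of [K], the levels, whose index and whose supply of
    homomorphisms to [F_p] both grow like the index of [V] ([level_covers],
    [level_homs]): the homology of [K] modulo [p] grows linearly along the tower.
    The theorem follows from this growth and from the finite presentation of
    [K], a phenomenon discovered by Lackenby.

    Instead of covering spaces of a presentation complex, the proof uses
    functions [f] from [K] to [F_p] with [f (h k) = f h + f k] for [h] in [H].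
    Such an equivariant function is a cocycle of the cover attached to [H], its
    restriction to [H] is its cohomology class, and pulling it back to a deeper
    level changes nothing. Its support is the set of edges [(k, x)] of the Cayley
    graph with [f (k x)] different from [f k], taken modulo [H].

    The heart of the argument ([stage_step]) makes supports small. Given
    independent cocycles [U_1, ..., U_u] at a level [H], pass to the common
    kernel [H'] of many homomorphisms [l_j] independent from the [U_m]. There
    the [l_j] are functions rather than classes, so the cup products
    [sum a_jm l_j dU_m] are 1-cochains of [H'], supported where the [U_m] are.
    They integrate to equivariant functions when their sums round the relators
    vanish, which is a number of linear conditions on [a] proportional to the
    index of [H], whereas the number of unknowns is about [u] times that index;
    as soon as [u] exceeds a constant of the presentation there are [u + 1]
    independent solutions ([cup_product_cocycles]). By the pigeonhole principle
    these take one and the same vector of [F_p^(u + 1)] as increment on a fixed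
    proportion of the support, and a [u]-dimensional space of their combinations
    vanishes there. Iterating, the support becomes arbitrarily small with respect
    to the rank of the level ([small_support]).

    When the support is small enough, a further cocycle [V] can be made to
    vanish on every edge that shares a relator with the support of the [U_m].
    Two families of cocycles that no relator sees simultaneously define a
    homomorphism to a free product, hence one to a free group on a deeper
    subgroup; its image is free by the Nielsen-Schreier theorem and not cyclic
    ([separated_p_large]). *)

Set Implicit Arguments.
Unset Strict Implicit.
Unset Printing Implicit Defensive.

Local Open Scope group_scope.

(** * Groups, homomorphisms and permutations *)

Record subgroup (G : groupType) (P : G -> Prop) : Prop := Subgroup {
  sg1 : P 1;
  sgM : forall x y, P x -> P y -> P (x * y);
  sgV : forall x, P x -> P x^-1
}.

Lemma sgX (G : groupType) (P : G -> Prop) (sP : subgroup P) x n :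
  P x -> P (x ^+ n).
Proof.
move=> Px; elim: n => [|n IH]; first exact: sg1.
by rewrite expgS; apply: sgM.
Qed.

Lemma sgMr (G : groupType) (P : G -> Prop) (sP : subgroup P) x y :
  P y -> P (x * y) -> P x.
Proof. by move=> Py Pxy; rewrite -(mulgK y x); apply: sgM => //; apply: sgV. Qed.

Lemma sgMl (G : groupType) (P : G -> Prop) (sP : subgroup P) x y :
  P x -> P (x * y) -> P y.
Proof. by move=> Px Pxy; rewrite -(mulKg x y); apply: sgM => //; apply: sgV. Qed.

Lemma ghom_exists (G H : groupType) (f : G -> H) :
  {morph f : x y / x * y} -> exists g : {ghom G -> H}, g =1 f.
Proof.
move=> fM.
have f1 : f 1 = 1 by apply: (mulgI (f 1)); rewrite -fM !mulg1.
pose m := isUMagmaMorphism.Build G H f (conj f1 fM : monoid_morphism f).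
pose g : {ghom G -> H} := HB.pack f m.
by exists g.
Qed.

Section SubgroupType.
Variables (G : groupType) (P : G -> Prop) (sP : subgroup P).

Definition sg_pred : {pred G} := [pred x | `[< P x >]].

Lemma sg_predP x : reflect (P x) (x \in sg_pred).
Proof. exact: asboolP. Qed.

Lemma sg_closed : group_closed sg_pred.
Proof.
split=> [|x y /sg_predP Px /sg_predP Py]; apply/sg_predP; first exact: sg1.
by apply: sgM => //; apply: sgV.
Qed.

Definition sg_type of subgroup P : Type := {x : G | x \in sg_pred}.
HB.instance Definition _ := SubChoice.on (sg_type sP).
HB.instance Definition _ :=
  SubChoice_isSubGroup.Build G _ (sg_type sP) sg_closed.

Lemma sg_typeP (u : sg_type sP) : P (val u).
Proof. exact/sg_predP/(valP u). Qed.

Definition sg_elt x (Px : P x) : sg_type sP :=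
  Sub x (introT (sg_predP x) Px).

Lemma sg_eltK x (Px : P x) : val (sg_elt Px) = x.
Proof. exact: SubK. Qed.

Lemma sg_valM (u v : sg_type sP) : val (u * v) = val u * val v.
Proof. exact: gmulfM. Qed.

Variables (H : groupType) (f : {ghom sg_type sP -> H}).

(** Extends a homomorphism from a subgroup by the constant 1, so that it can be
    applied to elements of the ambient group. *)
Definition sg_ext (x : G) : H :=
  if pselect (P x) is left Px then f (sg_elt Px) else 1.

Lemma sg_extE (u : sg_type sP) : sg_ext (val u) = f u.
Proof.
rewrite /sg_ext; case: pselect => [Pu|]; last by move/(_ (sg_typeP u)).
by congr (f _); apply: val_inj; rewrite sg_eltK.
Qed.

Lemma sg_extM x y : P x -> P y -> sg_ext (x * y) = sg_ext x * sg_ext y.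
Proof.
move=> Px Py; rewrite -(sg_eltK Px) -(sg_eltK Py) -sg_valM !sg_extE.
exact: gmulfM.
Qed.

End SubgroupType.

Record is_normal (G : groupType) (P : G -> Prop) : Prop := Normal {
  normal_sg :> subgroup P;
  normalJ : forall x y, P x -> P (x ^ y)
}.

Section NormalSubgroupOf.
Variables (G : groupType) (P : G -> Prop) (nP : is_normal P).

Lemma sg_predJ x y : x \in sg_pred P -> x ^ y \in sg_pred P.
Proof. by move=> /sg_predP Px; apply/sg_predP; exact: normalJ. Qed.

Definition nsub := NormalSubgroup (sg_closed nP) sg_predJ.

Lemma nsubP x : reflect (P x) (x \in nsub).
Proof. exact: sg_predP. Qed.

End NormalSubgroupOf.

(** Permutations of [T], composed from left to right so that they act on the
    right. *)
Record bij (T : Type) := Bij {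
  bij_fun :> T -> T;
  bij_inv : T -> T;
  bij_funK : cancel bij_fun bij_inv;
  bij_invK : cancel bij_inv bij_fun
}.

Section BijGroup.
Variable T : Type.

Lemma bij_eq (s t : bij T) : s =1 t -> s = t.
Proof.
case: s t => [f f' fK f'K] [g g' gK g'K] /= fg.
have fge : f = g by apply/funext.
subst g; have ge : f' = g'.
  by apply/funext => x; rewrite -[x in LHS]g'K fK.
by subst g'; congr Bij; apply: Prop_irrelevance.
Qed.

HB.instance Definition _ := gen_eqMixin (bij T).
HB.instance Definition _ := gen_choiceMixin (bij T).

Definition bij_one : bij T := @Bij T id id (fun=> erefl) (fun=> erefl).
Definition bij_mul (s t : bij T) : bij T :=
  Bij (can_comp (bij_funK t) (bij_funK s)) (can_comp (bij_invK s) (bij_invK t)).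
Definition bij_V (s : bij T) : bij T := Bij (bij_invK s) (bij_funK s).

Lemma bij_mulA : associative bij_mul. Proof. by move=> s t u; apply: bij_eq. Qed.
Lemma bij_mul1 : left_id bij_one bij_mul. Proof. by move=> s; apply: bij_eq. Qed.
Lemma bij_mulr1 : right_id bij_one bij_mul.
Proof. by move=> s; apply: bij_eq. Qed.
Lemma bij_mulV : left_inverse bij_one bij_V bij_mul.
Proof. by move=> s; apply: bij_eq => x /=; rewrite bij_invK. Qed.
Lemma bij_mulrV : right_inverse bij_one bij_V bij_mul.
Proof. by move=> s; apply: bij_eq => x /=; rewrite bij_funK. Qed.

HB.instance Definition _ := isGroup.Build (bij T)
  bij_mulA bij_mul1 bij_mulr1 bij_mulV bij_mulrV.

Lemma bijM (s t : bij T) x : (s * t) x = t (s x). Proof. by []. Qed.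

End BijGroup.

(** Additive groups written multiplicatively, so that one theory of cochains
    covers coefficients in [F_p] and in a free group. *)
Definition addgrp (A : zmodType) : Type := A.

Section AddGroup.
Variable A : zmodType.
HB.instance Definition _ := Choice.on (addgrp A).
Let add (x y : addgrp A) : addgrp A := (x + y : A)%R.
Let opp (x : addgrp A) : addgrp A := (- x : A)%R.
HB.instance Definition _ := isGroup.Build (addgrp A)
  (@GRing.addrA A : associative add) (@GRing.add0r A : left_id _ add)
  (@GRing.addr0 A : right_id _ add) (@GRing.addNr A : left_inverse _ opp add)
  (@GRing.addrN A : right_inverse _ opp add).

Lemma addgrpM (x y : addgrp A) : x * y = ((x : A) + y)%R. Proof. by []. Qed.
Lemma addgrp1 : (1 : addgrp A) = 0%R. Proof. by []. Qed.
Lemma addgrpV (x : addgrp A) : x^-1 = (- (x : A))%R. Proof. by []. Qed.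
End AddGroup.

(** * Words and cochains on Cayley graphs *)

Section Words.
Variables (X : Type) (K : groupType) (b : X -> K).
Implicit Types (k : K) (l : X * bool) (w : seq (X * bool)).

Definition letter_val l : K := if l.2 then b l.1 else (b l.1)^-1.
Definition word_val w : K := foldr (fun l k => letter_val l * k) 1 w.

Lemma word_val_cons l w : word_val (l :: w) = letter_val l * word_val w.
Proof. by []. Qed.

Lemma word_val_cat w1 w2 : word_val (w1 ++ w2) = word_val w1 * word_val w2.
Proof. by elim: w1 => [|l w IH] /=; rewrite ?mul1g // IH mulgA. Qed.

Definition winv w : seq (X * bool) := rev [seq (l.1, ~~ l.2) | l <- w].

Lemma word_val_winv w : word_val (winv w) = (word_val w)^-1.
Proof.
rewrite /winv; elim: w => [|l w IH] /=; first by rewrite invg1.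
rewrite rev_cons -cats1 word_val_cat IH invgM /= mulg1; congr (_ * _).
by rewrite /letter_val; case: l => x [] //=; rewrite invgK.
Qed.

Definition generates := forall k, exists w, k = word_val w.

Lemma generates_ind (gb : generates) (P : K -> Prop) :
  P 1 -> (forall k x, P k -> P (k * b x)) ->
  (forall k x, P k -> P (k * (b x)^-1)) -> forall k, P k.
Proof.
move=> P1 PM PV k; have [w ->] := gb k.
elim/last_ind: w => [|w [x s] Pw]; rewrite -?cats1 ?word_val_cat //=.
by rewrite mulg1 /letter_val; case: s => /=; [apply: PM | apply: PV].
Qed.

Variables (A : groupType) (c : K -> X -> A).

(** Moving along the letter [x] at [k] traverses the edge [(k, x)] of the Cayley
    graph; its inverse traverses the edge [(k / b x, x)] backwards. *)
Definition letter_step k l : A :=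
  if l.2 then c k l.1 else (c (k * (b l.1)^-1) l.1)^-1.

Fixpoint path_prod k w : A :=
  if w is l :: w' then letter_step k l * path_prod (k * letter_val l) w' else 1.

Lemma path_prod_cat k w1 w2 :
  path_prod k (w1 ++ w2) = path_prod k w1 * path_prod (k * word_val w1) w2.
Proof.
elim: w1 k => [|l w IH] k /=; first by rewrite mulg1 mul1g.
by rewrite IH !mulgA.
Qed.

Definition primitive (W : K -> A) :=
  W 1 = 1 /\ forall k x, W (k * b x) = W k * c k x.

Lemma primitive_path_prod W (iW : primitive W) k w :
  W (k * word_val w) = W k * path_prod k w.
Proof.
elim: w k => [|l w IH] k /=; first by rewrite !mulg1.
rewrite [k * _]mulgA IH [RHS]mulgA; congr (_ * _).
case: l => x [] /=; rewrite /letter_val /letter_step /=; first by rewrite iW.2.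
by rewrite -{2}(mulgVK (b x) k) iW.2 mulgK.
Qed.

Lemma primitive_eq W W' : generates -> primitive W -> primitive W' -> W =1 W'.
Proof.
move=> gb iW iW' k; have [w ->] := gb k.
by rewrite -[word_val w]mul1g !primitive_path_prod // iW.1 iW'.1.
Qed.

End Words.

(** The function [k |-> (W h)^-1 * W (h * k)] is a primitive of the translated
    cochain, so it is [W] when translation by [h] leaves the cochain unchanged. *)
Lemma primitive_shift (X : Type) (K : groupType) (b : X -> K) (A : groupType)
    (c : K -> X -> A) (W : K -> A) (h : K) :
  generates b -> primitive b c W -> (forall k x, c (h * k) x = c k x) ->
  forall k, W (h * k) = W h * W k.
Proof.
move=> gb iW ch k.
have i2 : primitive b c (fun k => (W h)^-1 * W (h * k)).
  split; first by rewrite mulg1 mulVg.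
  by move=> k' x; rewrite [h * _]mulgA iW.2 ch !mulgA.
by rewrite -[W k](primitive_eq gb i2 iW k) mulVKg.
Qed.

(** The group is presented by the generators [b] and the relators [rels], as
    seen by the cochains of its Cayley graph: those whose sums round the
    translates of the relators are trivial have primitives. *)
Definition presents (X : Type) (K : groupType) (b : X -> K)
    (rels : seq (seq (X * bool))) :=
  [/\ generates b,
      forall i, i < size rels -> word_val b (nth [::] rels i) = 1 &
      forall (A : groupType) (c : K -> X -> A),
        (forall k i, i < size rels -> path_prod b c k (nth [::] rels i) = 1) ->
        exists W, primitive b c W].

(** * Presentations and primitives *)

(** The uniqueness half of the universal property: a retraction onto the
    subgroup generated by [b] must be the identity. *)
Lemma free_on_generates (X : Type) (F : groupType) (b : X -> F) :
  free_on b -> generates b.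
Proof.
move=> fb; pose P k := exists w, k = word_val b w.
have sP : subgroup P.
  split; first by exists [::].
    by move=> x y [w ->] [w' ->]; exists (w ++ w'); rewrite word_val_cat.
  by move=> x [w ->]; exists (winv w); rewrite word_val_winv.
have Pb x : P (b x) by exists [:: (x, true)]; rewrite /= /letter_val mulg1.
have [f [fb1 _]] := fb (sg_type sP) (fun x => sg_elt sP (Pb x)).
have [g gE] : exists g : {ghom F -> F}, g =1 (fun k => val (f k)).
  by apply: ghom_exists => x y /=; rewrite gmulfM sg_valM.
have [i iE] : exists g : {ghom F -> F}, g =1 id by apply: ghom_exists.
have [h [_ hU]] := fb F b.
move=> k; suff -> : k = val (f k) by apply: (sg_typeP (f k)).
rewrite -gE -[LHS]iE (hU i) => [|x]; last exact: iE.
by rewrite (hU g) // => x; rewrite gE fb1 sg_eltK.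
Qed.

(** A cochain on [K] lets each generator permute [K * A], sending [(k, a)] to
    [(k * b x, a * c k x)]; the orbit of [(1, 1)] is the graph of a primitive
    as soon as the action descends from the free group to [K]. *)
Section Monodromy.
Variables (X : Type) (K : groupType) (b : X -> K) (A : groupType).
Variable c : K -> X -> A.

Definition mono_fun (x : X) (u : K * A) := (u.1 * b x, u.2 * c u.1 x).
Definition mono_inv (x : X) (u : K * A) :=
  (u.1 * (b x)^-1, u.2 * (c (u.1 * (b x)^-1) x)^-1).

Lemma mono_funK x : cancel (mono_fun x) (mono_inv x).
Proof. by move=> [k a]; rewrite /mono_fun /mono_inv /= !mulgK. Qed.
Lemma mono_invK x : cancel (mono_inv x) (mono_fun x).
Proof. by move=> [k a]; rewrite /mono_fun /mono_inv /= !mulgVK. Qed.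

Definition mono x : bij (K * A) := Bij (mono_funK x) (mono_invK x).

Lemma mono_word_val w u :
  word_val mono w u = (u.1 * word_val b w, u.2 * path_prod b c u.1 w).
Proof.
elim: w u => [|[x s] w IH] u; first by case: u => k a; rewrite /= !mulg1.
rewrite word_val_cons bijM IH /= /letter_val /letter_step.
by case: s => /=; rewrite !mulgA.
Qed.

End Monodromy.

Lemma free_primitive (X : Type) (F : groupType) (b : X -> F) (K A : groupType)
    (f : {ghom F -> K}) (c : K -> X -> A) : free_on b ->
  exists g : {ghom F -> bij (K * A)},
    forall w k a, g (word_val b w) (k, a)
      = (k * word_val (f \o b) w, a * path_prod (f \o b) c k w).
Proof.
move=> fb; have [g [gb _]] := fb (bij (K * A)) (mono (f \o b) c).
exists g => w k a; suff -> : g (word_val b w) = word_val (mono (f \o b) c) w.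
  by rewrite mono_word_val.
elim: w => [|[x []] w IH] /=; rewrite ?gmulf1 // gmulfM IH; congr (_ * _).
  by rewrite /letter_val /= gb.
by rewrite /letter_val /= gmulfV gb.
Qed.

Lemma free_on_presents (X : Type) (F : groupType) (b : X -> F) :
  free_on b -> presents b [::].
Proof.
move=> fb; have gb := free_on_generates fb.
split=> // A c _.
have [i iE] : exists g : {ghom F -> F}, g =1 id by apply: ghom_exists.
have ib : i \o b = b by apply/funext => x /=; rewrite iE.
have [g gE] := free_primitive i c fb.
rewrite {}ib in gE; exists (fun k => (g k (1, 1)).2); split.
  by rewrite gmulf1.
move=> k x; have [w ->] := gb k.
have -> : word_val b w * b x = word_val b (w ++ [:: (x, true)]).
  by rewrite word_val_cat /= mulg1.
by rewrite !gE word_val_cat path_prod_cat /= !mul1g mulg1.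
Qed.

(** The normal closure of the relators acts trivially on [K * A] as soon as the
    relators do, so the action of the free group factors through [K]. *)
Lemma finitely_presented_presents (K : groupType) : finitely_presented K ->
  exists n (b : 'I_n -> K) rels, presents b rels.
Proof.
move=> [n [F [b [f [R [fb fsurj finR kerf]]]]]].
have gb := free_on_generates fb.
have fev w : f (word_val b w) = word_val (f \o b) w.
  elim: w => [|[x s] w IH] /=; first by rewrite gmulf1.
  by rewrite gmulfM IH /letter_val; case: s; rewrite /= ?gmulfV.
have [s sE] := (finite_seqP R).1 finR.
pose word r := sval (cid (gb r)).
have wordE r : r = word_val b (word r) by rewrite /word; case: cid.
exists n, (f \o b), [seq word r | r <- s].
have sR i : i < size s -> f (word_val b (nth [::] [seq word r | r <- s] i)) = 1.
  move=> ilt; rewrite (nth_map 1) // -wordE.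
  suff : [set x | f x = 1]%classic (nth 1 s i) by [].
  rewrite kerf => N RN; apply: RN; rewrite sE /=; exact: mem_nth.
split.
- move=> k; have [x _ <-] := fsurj k I.
  by have [w ->] := gb x; exists w; rewrite fev.
- by move=> i; rewrite size_map => ilt; rewrite -fev sR.
move=> A c crel; have [g gE] := free_primitive f c fb.
have gker x y : f x = f y -> g x = g y.
  move=> fxy.
  have nker : is_normal (fun u => g u = 1).
    split; [split|] => [|u v|u|u v].
    - exact: gmulf1.
    - by move=> gu gv; rewrite gmulfM gu gv mulg1.
    - by move=> gu; rewrite gmulfV gu invg1.
    - by move=> gu; rewrite gmulfJ gu conj1g.
  have : [set x | f x = 1]%classic (x^-1 * y).
    by rewrite /= gmulfM gmulfV fxy mulVg.
  rewrite kerf => /(_ (nsub nker)) h.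
  have /(nsubP nker) : x^-1 * y \in nsub nker.
    apply: h => r; rewrite sE /= => rs.
    apply/(nsubP nker)/bij_eq => -[k a].
    have ilt : index r s < size s by rewrite index_mem.
    have rE : r = word_val b (nth [::] [seq word r | r <- s] (index r s)).
      by rewrite (nth_map 1) // -wordE nth_index.
    rewrite rE gE -fev sR // mulg1 crel ?size_map //.
    by rewrite mulg1.
  rewrite gmulfM gmulfV => e.
  by rewrite -[g y](mulVKg (g x)) e mulg1.
have lift k : {x | f x = k} by apply: cid; have [x _ <-] := fsurj k I; exists x.
exists (fun k => (g (sval (lift k)) (1, 1)).2); split.
  case: (lift 1) => x /= fx; rewrite (gker x 1) ?gmulf1 //.
move=> k x; case: (lift (k * _)) => y /= fy; case: (lift k) => z /= fz.
have [w wE] := gb z.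
rewrite (gker y (word_val b (w ++ [:: (x, true)]))); last first.
  by rewrite word_val_cat /= -wE fy gmulfM fz /letter_val /= mulg1.
rewrite wE !gE !mul1g -fz wE fev.
by rewrite path_prod_cat /= !mul1g mulg1.
Qed.

(** * Subgroups of free groups *)

Section Schreier.
Variables (X : Type) (F : groupType) (b : X -> F) (J : F -> Prop).
Hypotheses (fb : free_on b) (sJ : subgroup J).

Let gb : generates b := free_on_generates fb.

Let same (g h : F) := J (g * h^-1).

Let same_refl g : same g g. Proof. by rewrite /same mulgV; apply: sg1. Qed.
Let same_sym g h : same g h -> same h g.
Proof. by move=> /(sgV sJ); rewrite /same invgM invgK. Qed.
Let same_trans h g k : same g h -> same h k -> same g k.
Proof. by move=> gh hk; have := sgM sJ gh hk; rewrite mulgA mulgVK. Qed.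
Let sameM g h k : same g h -> same (g * k) (h * k).
Proof. by rewrite /same invgM mulgA mulgK. Qed.

Let len_ex g : exists n, `[< exists2 w, size w = n & same g (word_val b w) >].
Proof.
by have [w gw] := gb g; exists (size w); apply/asboolP; exists w; rewrite -?gw.
Qed.

(** Distance from the coset [J] in the Schreier graph. *)
Definition slen (g : F) : nat := ex_minn (len_ex g).

Let slen_word g : exists2 w, size w = slen g & same g (word_val b w).
Proof. by rewrite /slen; case: ex_minnP => m /asboolP. Qed.

Let slen_min g w : same g (word_val b w) -> slen g <= size w.
Proof.
move=> gw; rewrite /slen; case: ex_minnP => m _; apply.
by apply/asboolP; exists w.
Qed.

Let slen_same g g' : same g g' -> slen g = slen g'.
Proof.
move=> gg'; apply/eqP; rewrite eqn_leq.
have [w sw gw] := slen_word g; have [w' sw' gw'] := slen_word g'.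
apply/andP; split; [rewrite -sw' | rewrite -sw]; apply: slen_min.
  exact: same_trans gg' gw'.
exact: same_trans (same_sym gg') gw.
Qed.

Let parent_prop g : set (F * (X * bool)) :=
  fun u => same g (u.1 * letter_val b u.2) /\ slen g = (slen u.1).+1.

Let parent_same g g' : same g g' -> parent_prop g = parent_prop g'.
Proof.
move=> gg'; apply/funext => u; rewrite /parent_prop (slen_same gg').
apply/propext; split=> -[h ?]; split=> //; apply: same_trans h => //.
exact: same_sym.
Qed.

Let parent_ex g : slen g != 0 -> exists u, parent_prop g u.
Proof.
have [w sw gw] := slen_word g; case/lastP: w sw gw => [<-//|w l].
rewrite size_rcons => sw gw _.
have ewl v : word_val b (rcons v l) = word_val b v * letter_val b l.
  by rewrite -cats1 word_val_cat /= mulg1.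
exists (word_val b w, l); split; rewrite /= -?ewl //.
have [v sv hv] := slen_word (word_val b w).
apply/eqP; rewrite eqn_leq -[in X in _ && X]sw ltnS slen_min // andbT -sv.
have : same g (word_val b (rcons v l)).
  by apply: same_trans gw _; rewrite !ewl; apply: sameM.
by move/slen_min; rewrite size_rcons.
Qed.

(** A choice that depends on the set only, and so on the coset only when applied
    to sets attached to cosets. *)
Let pick (T : Type) (S : set T) : option T :=
  if pselect (exists u, S u) is left e then Some (sval (cid e)) else None.

(** The parent of a coset in a spanning tree of the Schreier graph, with the
    edge leading from it. *)
Let parent g := pick (parent_prop g).

Let parentP g : if parent g is Some u then parent_prop g u else slen g = 0.
Proof.
rewrite /parent /pick; case: pselect => [e|]; first by case: cid.
by move=> ne; apply/eqP/negPn/negP => /parent_ex.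
Qed.

Let tree n := iter n (fun (t : F -> F) g =>
  if parent g is Some u then t u.1 * letter_val b u.2 else 1) (fun=> 1).

(** The Schreier transversal: the representative of a coset is read off from
    its path in the spanning tree. *)
Definition srep g : F := tree (slen g) g.

Let srepE g :
  srep g = if parent g is Some u then srep u.1 * letter_val b u.2 else 1.
Proof.
rewrite /srep; have := parentP g; case pg: (parent g) => [u|] => [[_ gu]|->//].
by rewrite gu /= pg.
Qed.

Let srep_same g g' : same g g' -> srep g = srep g'.
Proof. by move=> gg'; rewrite 2!srepE /parent (parent_same gg'). Qed.

Let same_srep g : same g (srep g).
Proof.
have [n] := ubnP (slen g); elim: n g => // n IH g; rewrite ltnS => gn.
rewrite srepE; have := parentP g; case: parent => [[u l] [gul gu]|g0].
  by apply: same_trans gul _; apply: sameM; apply: IH; rewrite -gu.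
have [w] := slen_word g; rewrite g0 => /size0nil ->.
by [].
Qed.

Let srepK g : srep (srep g) = srep g.
Proof. exact/srep_same/same_sym/same_srep. Qed.

Let srep1 j : J j -> srep j = 1.
Proof.
move=> Jj; rewrite srepE; have := parentP j; case: parent => // u [_].
suff -> : slen j = 0 by [].
by apply/eqP; rewrite -leqn0 (@slen_min j [::]) //= /same invg1 mulg1.
Qed.

(** The edges of the Schreier graph outside the spanning tree, and the loops
    at the base point that traverse them. *)
Definition sedge : Type :=
  {u : F * X | srep u.1 = u.1 /\ u.1 * b u.2 <> srep (u.1 * b u.2)}.

Let loop (g : F) x := g * b x * (srep (g * b x))^-1.

Definition sloop (y : sedge) : sg_type sJ :=
  sg_elt sJ (same_srep ((sval y).1 * b (sval y).2)).

(** A prescription on the loops is a cochain on the Schreier graph that is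
    trivial on the spanning tree. Lifted to the Cayley graph of [F] it has a
    primitive, which restricts to a homomorphism on [J] by invariance; it is
    trivial on the transversal, because the transversal runs along the tree, and
    so takes the prescribed values. *)
Lemma nielsen_schreier_basis : free_on sloop.
Proof.
move=> L h.
pose hh (u : F * X) : L :=
  if pselect (srep u.1 = u.1 /\ u.1 * b u.2 <> srep (u.1 * b u.2)) is left p
  then h (exist _ u p) else 1.
pose c g x := hh (srep g, x).
have hh1 g x : g * b x = srep (g * b x) -> hh (g, x) = 1.
  by move=> e; rewrite /hh; case: pselect => // p; case: (proj2 p e).
have [_ _ /(_ L c) []] := free_on_presents fb; first by [].
move=> W iW.
have WM j g : J j -> W (j * g) = W j * W g.
  move=> Jj; apply: (primitive_shift gb iW) => k x; rewrite /c.
  by rewrite (@srep_same (j * k) k) // /same mulgK.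
have Wt g : W (srep g) = 1.
  have [n] := ubnP (slen g); elim: n g => // n IH g; rewrite ltnS => gn.
  have gE := srepE g; have := parentP g.
  case: parent gE => [[u [x s]] gE [gul gu]|-> _]; last exact: iW.1.
  have Wu : W (srep u) = 1 by apply: IH; rewrite -[(slen u).+1]gu.
  rewrite /= in gE gul gu.
  case: s gE gul => gE gul; rewrite /letter_val /= in gE gul.
    rewrite gE iW.2 Wu mul1g /c srepK hh1 // -gE; apply: srep_same.
    exact: same_srep.
  have e : srep u = srep g * b x by rewrite gE mulgVK.
  have := iW.2 (srep g) x; rewrite -e Wu /c srepK hh1 ?mulg1 ?gE //.
  by rewrite -gE -e srepK.
have [f fE] : exists f : {ghom sg_type sJ -> L}, f =1 fun u => W (val u).
  by apply: ghom_exists => u v; rewrite (sg_valM u v) WM //; apply: sg_typeP.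
have fy y : f (sloop y) = h y.
  rewrite fE /sloop sg_eltK; case: y => -[g x] [/= ge ye].
  have := WM _ (srep (g * b x)) (same_srep (g * b x)).
  rewrite mulgVK Wt mulg1 iW.2 -{1}ge Wt mul1g => <-.
  have -> : c g x = hh (g, x) by rewrite /c ge.
  rewrite /hh; case: pselect => [p|]; last by case; split.
  by congr h; apply: eq_exist.
exists f; split=> // f' f'E v.
have fW g : J g -> W g = sg_ext f g.
  by move=> Jg; rewrite -(sg_eltK sJ Jg) sg_extE fE.
pose D g := g * (srep g)^-1.
have JD g : J (D g) := same_srep g.
have DM g x : D (g * b x) = D g * loop (srep g) x.
  rewrite /D /loop (@srep_same (srep g * b x) (g * b x)) ?mulgA ?mulgVK //.
  by apply: sameM; apply: same_sym; apply: same_srep.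
have Jloop g x : J (loop (srep g) x) by apply: same_srep.
have f'W g x : sg_ext f' (loop (srep g) x) = W (loop (srep g) x).
  have [e|ne] := EM (srep g * b x = srep (srep g * b x)).
    by rewrite /loop -e mulgV iW.1; have := sg_extE f' 1; rewrite !gmulf1.
  pose y : sedge := exist _ (srep g, x) (conj (srepK g) ne).
  have -> : loop (srep g) x = val (sloop y) by rewrite /sloop sg_eltK.
  by rewrite sg_extE f'E -fE fy.
have f'D g : sg_ext f' (D g) = W (D g).
  elim/(generates_ind gb): g => [|g x IH|g x IH].
  - rewrite /D srep1 ?mulgV ?iW.1; last exact: sg1.
    by have := sg_extE f' 1; rewrite !gmulf1.
  - by rewrite DM sg_extM // IH f'W WM.
  apply: (mulIg (sg_ext f' (loop (srep (g * (b x)^-1)) x))).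
  by rewrite -sg_extM // -DM mulgVK IH f'W -WM // -DM mulgVK.
have := f'D (val v); rewrite /D srep1 ?invg1 ?mulg1; last exact: sg_typeP.
by rewrite sg_extE fE.
Qed.

End Schreier.

Theorem nielsen_schreier (F : groupType) (J : F -> Prop) (sJ : subgroup J) :
  free_group F -> free_group (sg_type sJ).
Proof.
move=> [X [b fb]]; exists (sedge fb sJ), (@sloop _ _ b _ fb sJ).
exact: nielsen_schreier_basis.
Qed.

(** * Subgroups of p-power index *)

(** A group in bijection with ['I_n] is carried by its regular representation
    into the permutations of ['I_n], where the theory of finite groups applies. *)
Section FiniteGroup.
Import fingroup perm cyclic pgroup.
Variables (Q : groupType) (n : nat) (u : Q -> 'I_n) (v : 'I_n -> Q).
Hypotheses (uK : cancel u v) (vK : cancel v u).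

Let reg_inj x : injective (fun i => u (v i * x)).
Proof. by move=> i j /(can_inj uK)/mulIg/(can_inj vK). Qed.

Let reg x : {perm 'I_n} := perm (@reg_inj x).

Let regM x y : reg (x * y) = reg x * reg y.
Proof. by apply/permP => i; rewrite permM !permE uK mulgA. Qed.

Let reg_injective : injective reg.
Proof.
move=> x y /permP/(_ (u 1)); rewrite !permE uK !mul1g; exact: (can_inj uK).
Qed.

Let reg1 : reg 1 = 1.
Proof. by apply: (mulgI (reg 1)); rewrite -regM !mulg1. Qed.

Let regX x m : reg (x ^+ m) = reg x ^+ m.
Proof.
by elim: m => [|m IH]; rewrite ?reg1 // !expgS regM IH.
Qed.

Let R : {set {perm 'I_n}} := [set reg (v i) | i in 'I_n].

Let inR x : reg x \in R.
Proof. by apply/imsetP; exists (u x); rewrite ?uK. Qed.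

Let R_group : group_set R.
Proof.
apply/group_setP; split=> [|_ _ /imsetP[i _ ->] /imsetP[j _ ->]].
  by rewrite -reg1 inR.
by rewrite -regM inR.
Qed.

Let gR : {group {perm 'I_n}} := Group R_group.

Let card_R : #|gR| = n.
Proof. by rewrite card_imset ?card_ord // => i j /reg_injective/(can_inj vK). Qed.

Lemma finite_expg_card (x : Q) : x ^+ n = 1.
Proof.
apply: reg_injective; rewrite regX reg1.
apply/eqP; rewrite -order_dvdn -[X in _ %| X]card_R.
exact: (@order_dvdG _ gR) (inR x).
Qed.

Lemma finite_torsion_pgroup p : prime p ->
  (forall x : Q, exists j, x ^+ (p ^ j)%N = 1) -> exists k, n = (p ^ k)%N.
Proof.
move=> p_pr tors; have n0 : (0 < n)%N by case: (u 1) => m; case: (n).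
suff /p_natP[k ->] : p.-nat n by exists k.
apply/pnatP => // q q_pr qn; rewrite -card_R in qn.
have [_ /imsetP[i _ ->] ord_q] := Cauchy q_pr qn.
have [j /(congr1 reg)] := tors (v i).
rewrite regX reg1 => /eqP; rewrite -order_dvdn ord_q Euclid_dvdX // => /andP[qp _].
by rewrite inE /= -(dvdn_prime2 q_pr p_pr).
Qed.

End FiniteGroup.

Lemma card_II_cancel (T : Type) n : ([set: T] #= `I_n)%card ->
  exists (u : T -> 'I_n) (v : 'I_n -> T), cancel u v /\ cancel v u.
Proof.
move=> /card_set_bijP[u [uI uinj usurj]].
have ult (x : T) : (u x < n)%N by apply: uI.
have vex (i : 'I_n) : exists x, u x = i.
  by have [x _ ux] := usurj i (ltn_ord i); exists x.
exists (fun x => Ordinal (ult x)), (fun i => sval (cid (vex i))).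
split=> [x | i]; last by apply: val_inj => /=; case: cid.
by apply: uinj; rewrite ?inE //; case: cid.
Qed.

(** A labelling by a finite type stands for a finite set of cosets: unlike a
    cardinal, it is easily produced for intersections and cores. *)
Definition finite_mod (G : groupType) (N A : G -> Prop) :=
  exists (T : finType) (f : G -> T),
    forall x y, N x -> N y -> f x = f y -> A (x^-1 * y).

Definition p_torsion_mod (p : nat) (G : groupType) (N A : G -> Prop) :=
  forall x, N x -> exists j, A (x ^+ (p ^ j)%N).

Record p_normal (p : nat) (G : groupType) (N : G -> Prop) : Prop := PNormal {
  p_normal_normal :> is_normal N;
  p_normal_fin : finite_mod xpredT N;
  p_normal_tors : p_torsion_mod p xpredT N
}.

Section PNormal.
Local Open Scope quotient_scope.
Local Open Scope group_scope.
Variables (p : nat) (p_pr : prime p).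

Lemma p_torsionS (G : groupType) (A : G -> Prop) (sA : subgroup A) x j k :
  (j <= k)%N -> A (x ^+ (p ^ j)%N) -> A (x ^+ (p ^ k)%N).
Proof.
by move=> jk Ax; rewrite -(subnKC jk) expnD expgnA; apply: sgX.
Qed.

(** One direction is Lagrange's theorem, the other one Cauchy's. *)
Lemma ppower_index_p_normal (G : groupType) (N : normalSubgroup G) :
  ppower_index p N <-> p_normal p (fun x => x \in N).
Proof.
have piX x k : \pi_(quotg N) (x ^+ k) = (\pi_(quotg N) x) ^+ k.
  elim: k => [|k IH]; first by rewrite !expg0.
  by rewrite !expgS pi_quotgM IH.
have pi1 x : \pi_(quotg N) x = 1 <-> x \in N.
  split=> [/esym/quotgP|xN]; first by rewrite invg1 mul1g.
  by apply/esym/quotgP; rewrite invg1 mul1g.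
split=> [[k card]|].
  have [u [v [uK vK]]] := card_II_cancel card.
  split.
  - split; first split.
    + exact: ns1.
    + exact: nsM.
    + exact: nsV.
    + exact: ns_conj.
  - exists 'I_(p ^ k), (fun x => u (\pi_(quotg N) x)) => x y _ _.
    by move/(can_inj uK)/quotgP.
  - move=> x _; exists k; apply/pi1; rewrite piX.
    exact: (finite_expg_card uK vK).
case=> nN [T [f fE]] tors.
have finQ : finite_set [set: quotg N].
  apply: (@finite_preimage _ _ setT (fun x : quotg N => f (repr x))).
    move=> x y _ _ /fE => /(_ isT isT)/quotgP.
    by rewrite !reprK.
  exact: finite_finset.
have [n card] := finQ.
have [u [v [uK vK]]] := card_II_cancel card.
have [|k nE] := finite_torsion_pgroup uK vK p_pr.
  move=> x; have [j h] := tors (repr x) isT; exists j.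
  by rewrite -[x]reprK -piX; apply/pi1.
by exists k; rewrite -nE.
Qed.

End PNormal.

Lemma p_normalI p (G : groupType) (M N : G -> Prop) :
  p_normal p M -> p_normal p N -> p_normal p (fun x => M x /\ N x).
Proof.
move=> [nM [T [f fM]] tM] [nN [U [g gN]] tN]; split.
- split; first split.
  + by split; [apply: (sg1 nM) | apply: (sg1 nN)].
  + by move=> x y [? ?] [? ?]; split; [apply: (sgM nM) | apply: (sgM nN)].
  + by move=> x [? ?]; split; [apply: (sgV nM) | apply: (sgV nN)].
  + by move=> x y [? ?]; split; [apply: (normalJ nM) | apply: (normalJ nN)].
- exists (T * U)%type, (fun x => (f x, g x)) => x y _ _ [fxy gxy].
  by split; [apply: fM | apply: gN].
move=> x _; have [i Mi] := tM x isT; have [j Nj] := tN x isT.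
exists (maxn i j).
by split; [apply: (p_torsionS nM (leq_maxl i j))
  | apply: (p_torsionS nN (leq_maxr i j))].
Qed.

Lemma p_normalT p (G : groupType) : p_normal p (fun _ : G => True).
Proof.
split.
- by split; first split.
- by exists unit, (fun=> tt).
- by move=> x _; exists 0.
Qed.

(** A normal subgroup of [N] has finitely many conjugates in [G], because its
    conjugate by [g] depends on the coset of [g] modulo [N] only; the
    intersection of the conjugates is thus still of finite index. *)
Lemma p_normal_core p (G : groupType) (N A : G -> Prop) :
  p_normal p N -> subgroup A -> (forall x, A x -> N x) ->
  (forall x y, N y -> A x -> A (x ^ y)) ->
  finite_mod N A -> p_torsion_mod p N A ->
  exists2 M, p_normal p M & forall x, M x -> A x.
Proof.
move=> [nN [T [f fN]] tN] sA AN AJ [U [h hA]] tA.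
pose rep t := if pselect (exists g, f g = t) is left e then sval (cid e) else 1.
have repP g : N ((rep (f g))^-1 * g).
  apply: fN => //; rewrite /rep; case: pselect => [e|]; first by case: cid.
  by case; exists g.
have NJ := normalJ nN.
exists (fun x => forall g, A (x ^ g)); last by move=> x /(_ 1); rewrite conjg1.
split.
- split; first split.
  + by move=> g; rewrite conj1g; apply: (sg1 sA).
  + by move=> x y Mx My g; rewrite conjMg; apply: (sgM sA).
  + by move=> x Mx g; rewrite conjVg; apply: (sgV sA).
  + by move=> x y Mx g; rewrite -conjgM; apply: Mx.
- exists (T * {ffun T -> U})%type,
    (fun x => (f x, [ffun t => h (((rep (f x))^-1 * x) ^ rep t)])).
  move=> x y _ _ [fxy /ffunP hxy] g.
  have gE : g = rep (f g) * ((rep (f g))^-1 * g) by rewrite mulVKg.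
  rewrite gE conjgM; apply: AJ; first exact: repP.
  have := hxy (f g); rewrite !ffunE => /hA.
  rewrite -conjVg -conjMg invgM mulgA -fxy mulgVK; apply; apply: NJ => //.
  by rewrite fxy.
move=> x _; have [i Ni] := tN x isT.
have kP t : exists k, A (((x ^+ (p ^ i)%N) ^ rep t) ^+ (p ^ k)%N).
  by apply: tA; apply: NJ.
pose k t := sval (cid (kP t)).
exists (i + \max_t k t)%N => g.
have gE : g = rep (f g) * ((rep (f g))^-1 * g) by rewrite mulVKg.
rewrite expnD expgnA conjXg {1}gE conjgM -conjXg; apply: AJ; first exact: repP.
apply: (p_torsionS sA (j := k (f g))); first exact: leq_bigmax.
by rewrite /k; case: cid.
Qed.

(** * Linear algebra over a finite field *)

Import GRing.Theory.

Section LinearAlgebra.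
Local Open Scope ring_scope.
Variable F : finFieldType.

Definition lin (T : Type) D (a : 'rV[F]_D) (f : 'I_D -> T -> F) (t : T) : F :=
  \sum_i a 0 i * f i t.

Definition indep (T : Type) (S : T -> Prop) D (f : 'I_D -> T -> F) :=
  forall a : 'rV[F]_D, (forall t, S t -> lin a f t = 0) -> a = 0.

Lemma linD (T : Type) D (a b : 'rV[F]_D) (f : 'I_D -> T -> F) t :
  lin (a + b) f t = lin a f t + lin b f t.
Proof. by rewrite -big_split; apply: eq_bigr => i _; rewrite !mxE mulrDl. Qed.

Lemma linZ (T : Type) D c (a : 'rV[F]_D) (f : 'I_D -> T -> F) t :
  lin (c *: a) f t = c * lin a f t.
Proof. by rewrite mulr_sumr; apply: eq_bigr => i _; rewrite !mxE mulrA. Qed.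

Lemma lin0 (T : Type) D (f : 'I_D -> T -> F) t : lin 0 f t = 0.
Proof. by rewrite /lin big1 // => i _; rewrite mxE mul0r. Qed.

Lemma lin_mulmx (T : Type) d D (a : 'rV[F]_d) (B : 'M_(d, D))
    (f : 'I_D -> T -> F) t :
  lin (a *m B) f t = lin a (fun i => lin (row i B) f) t.
Proof.
rewrite /lin; under eq_bigr do rewrite mxE mulr_suml.
rewrite exchange_big; apply: eq_bigr => i _; rewrite mulr_sumr.
by apply: eq_bigr => j _; rewrite mxE mulrA.
Qed.

Lemma indep_row_free (T : Type) (S : T -> Prop) d D (B : 'M_(d, D))
    (f : 'I_D -> T -> F) :
  row_free B -> indep S f -> indep S (fun i => lin (row i B) f).
Proof.
move=> fB fi a aB; apply/eqP; rewrite -(mulmx_free_eq0 a fB); apply/eqP.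
by apply: fi => t St; rewrite lin_mulmx aB.
Qed.

Lemma row_free_sub e m D (A : 'M[F]_(m, D)) : (e <= \rank A)%N ->
  exists2 B : 'M_(e, D), row_free B & (B <= A)%MS.
Proof.
move=> eA; exists ((pid_mx e : 'M_(e, \rank A)) *m row_base A).
  rewrite /row_free mxrankMfree ?row_base_free // rank_pid_mx //.
by apply: submx_trans (submxMl _ _) _; rewrite eq_row_base.
Qed.

Lemma homogeneous_solutions (T : eqType) D e (phi : T -> 'I_D -> F)
    (ts : seq T) : (size ts + e <= D)%N ->
  exists2 B : 'M_(e, D), row_free B &
    forall t i, t \in ts -> \sum_j B i j * phi t j = 0.
Proof.
move=> sD; pose n := size ts.
pose M : 'M_(D, n) := \matrix_(i, j) (nth (fun=> 0) (map phi ts) j) i.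
have rk : (e <= \rank (kermx M))%N.
  rewrite mxrank_ker leq_subRL; last by rewrite rank_leq_row.
  by apply: leq_trans sD; rewrite leq_add2r rank_leq_col.
have [B fB /sub_kermxP BM] := row_free_sub rk.
exists B => // t i tts; have ilt : (index t ts < n)%N by rewrite index_mem.
have /matrixP/(_ i (Ordinal ilt)) := BM; rewrite !mxE => e0.
rewrite -[RHS]e0; by apply: eq_bigr => j _; rewrite mxE /= (nth_map t) ?nth_index.
Qed.

(** The space is spanned by its elements, of which there are finitely many. *)
Lemma subspace_matrix D (Z : 'rV[F]_D -> Prop) : Z 0 ->
  (forall u v, Z u -> Z v -> Z (u + v)) -> (forall c u, Z u -> Z (c *: u)) ->
  exists A : 'M_D, forall v, Z v <-> (v <= A)%MS.
Proof.
move=> Z0 ZD ZZ; pose S := [pred v : 'rV[F]_D | `[< Z v >]].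
exists (\sum_(v | S v) <<v>>)%MS => v; split=> [Zv|].
  by apply: (sumsmx_sup v); [exact/asboolP | rewrite genmxE].
case/sub_sumsmxP => u ->; apply: big_ind => // w /asboolP Zw.
have : (u w *m <<w>> <= w)%MS.
  by apply: submx_trans (submxMl _ _) _; rewrite genmxE.
by case/sub_rVP => c ->; apply: ZZ.
Qed.

Lemma pigeonhole (T : Type) (V : finType) (f : T -> V) (s : seq T) (v0 : V) :
  exists v, (size s <= #|V| * count (fun t => f t == v) s)%N.
Proof.
have sumE : size s = (\sum_v count (fun t => f t == v) s)%N.
  elim: s => [|t s IH] /=; first by rewrite big1.
  rewrite big_split /= -IH (bigD1 (f t)) //= eqxx big1 ?addn0 // => v /negPf.
  by rewrite eq_sym => ->.
have V0 : (0 < #|V|)%N by apply/card_gt0P; exists v0.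
have [v vE] := eq_bigmax (fun v => count (fun t => f t == v) s) V0.
exists v; rewrite -vE sumE -sum_nat_const.
by apply: leq_sum => w _; apply: leq_bigmax.
Qed.

End LinearAlgebra.

(** * Equivariant functions and homomorphisms to F_p *)

Section SubgroupHoms.
Variables (p : nat) (p_pr : prime p) (K : groupType).
Implicit Types (H : K -> Prop) (f : K -> 'F_p).

Definition hom_on H f := forall x y, H x -> H y -> f (x * y) = (f x + f y)%R.

(** Such an [f] is an [H]-invariant cocycle in disguise: its increments along
    the edges of the Cayley graph of [K] are invariant under [H], and its class
    in [H^1(H)] is its restriction to [H]. *)
Definition equivariant H f := forall h k, H h -> f (h * k) = (f h + f k)%R.

Lemma equivariant_hom H f : equivariant H f -> hom_on H f.
Proof. by move=> fH x y Hx _; apply: fH. Qed.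

Lemma hom_onS H H' f : (forall h, H' h -> H h) -> hom_on H f -> hom_on H' f.
Proof. by move=> HH fH x y /HH Hx /HH; apply: fH. Qed.

Lemma lin_hom H D (a : 'rV['F_p]_D) (f : 'I_D -> K -> 'F_p) :
  (forall i, hom_on H (f i)) -> hom_on H (lin a f).
Proof.
move=> fH x y Hx Hy; rewrite /lin -big_split /=.
by apply: eq_bigr => i _; rewrite fH // mulrDr.
Qed.

Lemma lin_equivariant H D (a : 'rV['F_p]_D) (f : 'I_D -> K -> 'F_p) :
  (forall i, equivariant H (f i)) -> equivariant H (lin a f).
Proof.
move=> fH x y Hx; rewrite /lin -big_split /=.
by apply: eq_bigr => i _; rewrite fH // mulrDr.
Qed.

Lemma hom_on1 H f : subgroup H -> hom_on H f -> f 1 = 0%R.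
Proof.
move=> sH fH; have H1 := sg1 sH; have := fH _ _ H1 H1.
by rewrite mulg1 => /eqP; rewrite -subr_eq0 opprD addNKr oppr_eq0 => /eqP.
Qed.

Lemma hom_onV H f x : subgroup H -> hom_on H f -> H x -> f x^-1 = (- f x)%R.
Proof.
move=> sH fH Hx; apply: (addrI (f x)).
by rewrite -fH ?mulgV ?subrr ?(hom_on1 sH fH) //; apply: sgV.
Qed.

Lemma hom_onX H f x n : subgroup H -> hom_on H f -> H x ->
  f (x ^+ n) = (f x *+ n)%R.
Proof.
move=> sH fH Hx; elim: n => [|n IH]; first by rewrite expg0 (hom_on1 sH fH).
by rewrite expgS fH // ?IH ?mulrS //; apply: sgX.
Qed.

Lemma hom_onJ H f x y : subgroup H -> hom_on H f -> H x -> H y ->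
  f (x ^ y) = f x.
Proof.
move=> sH fH Hx Hy; have Hy' := sgV sH Hy.
rewrite conjgE fH ?fH //; last exact: sgM.
by rewrite (hom_onV sH fH Hy) addrCA addNr addr0.
Qed.

Lemma Fp_mulrn_p (x : 'F_p) : (x *+ p = 0)%R.
Proof. by apply: mulrn_pchar; apply: pchar_Fp. Qed.

Definition joint_ker H (J : Type) (f : J -> K -> 'F_p) k :=
  H k /\ forall j, f j k = 0%R.

Lemma joint_ker_subgroup H (J : Type) (f : J -> K -> 'F_p) : subgroup H ->
  (forall j, hom_on H (f j)) -> subgroup (joint_ker H f).
Proof.
move=> sH fH; split.
- by split=> [|j]; [apply: sg1 | apply: hom_on1 (fH j)].
- move=> x y [Hx fx] [Hy fy]; split=> [|j]; first exact: sgM.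
  by rewrite fH // fx fy addr0.
- move=> x [Hx fx]; split=> [|j]; first exact: sgV.
  by rewrite (hom_onV sH (fH j)) // fx oppr0.
Qed.

(** [H] is open in the pro-[p] topology. *)
Definition p_open H := exists2 N, p_normal p N & forall x, N x -> H x.

(** The common kernel need not be normal in [K], but it contains the core of its
    intersection with a normal subgroup of [p]-power index. *)
Lemma joint_ker_open H (J : finType) (f : J -> K -> 'F_p) : subgroup H ->
  (forall j, hom_on H (f j)) -> p_open H -> p_open (joint_ker H f).
Proof.
move=> sH fH [N nN NH].
have fN j : hom_on N (f j) by apply: hom_onS (fH j).
have [M nM MA] : p_open (joint_ker N f).
  have sN : subgroup N by exact: nN.
  apply: (p_normal_core nN).
  - exact: joint_ker_subgroup.
  - by move=> x [].
  - move=> x y Ny [Nx fx]; split; first exact: normalJ nN _ _ Nx.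
    by move=> j; rewrite (hom_onJ sN (fN j)).
  - exists {ffun J -> 'F_p}, (fun x => [ffun j => f j x]) => x y Nx Ny /ffunP fxy.
    split=> [|j]; first by apply: sgM => //; apply: sgV.
    have Nx' := sgV sN Nx; have := fxy j; rewrite !ffunE => e.
    by rewrite fN // (hom_onV sN (fN j)) // e addNr.
  move=> x Nx; exists 1%N; split=> [|j]; first exact: sgX.
  by rewrite (hom_onX _ sN (fN j)) // expn1 Fp_mulrn_p.
by exists M => // x /MA[Nx fx]; split; first exact: NH.
Qed.

(** Independent homomorphisms to [F_p] take all values simultaneously: a proper
    subspace of values would be annihilated by a linear form. *)
Lemma indep_surj H u (U : 'I_u -> K -> 'F_p) : subgroup H ->
  (forall i, hom_on H (U i)) -> indep H U ->
  forall e : 'I_u -> 'F_p, exists2 h, H h & forall i, U i h = e i.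
Proof.
move=> sH UH Ui e.
pose Z (v : 'rV['F_p]_u) := exists2 h, H h & forall i, U i h = v 0%R i.
have [A ZA] : exists A : 'M_u, forall v, Z v <-> (v <= A)%MS.
  apply: subspace_matrix.
  - exists 1; first exact: sg1.
    by move=> i; rewrite mxE (hom_on1 sH (UH i)).
  - move=> v w [h Hh hv] [k Hk kw]; exists (h * k); first exact: sgM.
    by move=> i; rewrite UH // mxE hv kw.
  - move=> c v [h Hh hv]; exists (h ^+ c); first exact: sgX.
    move=> i; rewrite (hom_onX _ sH (UH i)) // mxE hv -mulr_natl.
    by rewrite natr_Zp.
suff fullA : row_full A.
  have /ZA[h Hh he] : ((\row_i e i)%R <= A)%MS by apply: submx_full.
  by exists h => // i; rewrite he mxE.
rewrite -cokermx_eq0; apply/eqP/matrixP => i j; rewrite [RHS]mxE.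
have : ((col j (cokermx A))^T = 0)%R.
  apply: Ui => h Hh.
  have : ((\row_i U i h)%R <= A)%MS by apply/ZA; exists h => // l; rewrite mxE.
  rewrite submxE => /eqP/matrixP/(_ 0%R j); rewrite !mxE => e0.
  by rewrite /lin -[RHS]e0; apply: eq_bigr => l _; rewrite !mxE mulrC.
by move/matrixP/(_ 0%R i); rewrite !mxE.
Qed.

(** Equal cosets are equal predicates, and the same element is chosen for equal
    predicates. *)
Lemma coset_representatives H : subgroup H -> exists t : K -> K,
  (forall k, H (k * (t k)^-1)) /\ forall h k, H h -> t (h * k) = t k.
Proof.
move=> sH; pose S k : set K := fun u => H (k * u^-1).
have S1 k : S k k by rewrite /S mulgV; apply: sg1.
pose pick (A : set K) := if pselect (exists u, A u) is left e
  then sval (cid e) else 1.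
exists (fun k => pick (S k)); split=> [k|h k Hh].
  rewrite /pick; case: pselect => [e|]; first by case: cid.
  by case; exists k.
congr pick; apply/funext => u; apply/propext; rewrite /S -mulgA.
by split=> [/(sgMl sH Hh)//|]; apply: sgM.
Qed.

Lemma equivariant_extension H f : subgroup H -> hom_on H f ->
  exists2 f', equivariant H f' & forall h, H h -> f' h = f h.
Proof.
move=> sH fH; have [t [Ht tH]] := coset_representatives sH.
(* The constant makes [f'] vanish at 1, so that it extends [f]. *)
pose f' k := (f (k * (t k)^-1)%g - f (t 1%g)^-1%g)%R.
have Ht1 : H (t 1)^-1 by have := Ht 1; rewrite mul1g.
have f'H h k : H h -> f' (h * k) = (f h + f' k)%R.
  by move=> Hh; rewrite /f' tH // -mulgA (fH h _ Hh (Ht k)) -addrA.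
have f'E h : H h -> f' h = f h.
  by move=> Hh; rewrite -[h]mulg1 f'H // /f' mul1g subrr addr0 mulg1.
exists f'; last exact: f'E.
by move=> h k Hh; rewrite f'H // (f'E h).
Qed.

End SubgroupHoms.

(** * Homology of finite-index subgroups of free groups *)

(** The index of [H] is recorded by a label type, since passing to a subgroup
    multiplies label types; see [index_joint_ker]. *)
Definition index_by (K : groupType) (H : K -> Prop) (R : Type) (rho : K -> R) :=
  (forall g g', rho g = rho g' <-> H (g * g'^-1)) /\
  forall i, exists g, rho g = i.

(** A coset of the joint kernel is a coset of [H] together with the values of the
    [f j] on the quotient by its representative; independence makes all values
    occur. *)
Lemma index_joint_ker p (K : groupType) (H : K -> Prop) (R : Type)
    (rho : K -> R) d (f : 'I_d -> K -> 'F_p) :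
  subgroup H -> index_by H rho -> (forall i, hom_on H (f i)) -> indep H f ->
  exists rho' : K -> R * 'rV['F_p]_d, index_by (joint_ker H f) rho'.
Proof.
move=> sH [rhoE rhos] fH fi; pose r i := sval (cid (rhos i)).
have rK i : rho (r i) = i by rewrite /r; case: cid.
have Hr g : H (g * (r (rho g))^-1) by apply/rhoE; rewrite rK.
have split_quot (a c g : K) : a * g^-1 = (a * c^-1) * (g * c^-1)^-1.
  by rewrite invgM invgK mulgA mulgVK.
exists (fun g => (rho g, (\row_j f j (g * (r (rho g))^-1)%g)%R)); split.
  move=> g g'; split=> [[rgg' /rowP fgg']|[Hgg' fgg']].
    have Hg' := Hr g'; rewrite -rgg' in Hg'.
    split=> [|j]; first exact/rhoE.
    rewrite (split_quot _ (r (rho g))) fH //; last exact: sgV.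
    have := fgg' j; rewrite !mxE -rgg' => ->.
    by rewrite (hom_onV sH (fH j)) // subrr.
  have rgg' : rho g = rho g' by apply/rhoE.
  congr pair => //; apply/rowP => j; rewrite !mxE -rgg'.
  have Hg' := Hr g'; rewrite -rgg' in Hg'.
  have := fgg' j; rewrite (split_quot _ (r (rho g))) fH //; last exact: sgV.
  by rewrite (hom_onV sH (fH j)) // => /eqP; rewrite subr_eq0 => /eqP.
case=> i v; have [h Hh hv] := indep_surj sH fH fi (fun j => v 0%R j).
have rhi : rho (h * r i) = i by rewrite -{2}(rK i); apply/rhoE; rewrite mulgK.
exists (h * r i); rewrite rhi; congr pair; apply/rowP => j.
by rewrite mxE mulgK hv.
Qed.

Section FreeHoms.
Variables (p : nat) (X : Type) (F : groupType) (b : X -> F) (x1 x2 : X).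
Hypotheses (fb : free_on b) (x12 : x1 <> x2).
Variables (V : F -> Prop) (R : finType) (rho : F -> R).
Hypothesis rhoV : index_by V rho.
Local Notation N := #|R|.

(** Schreier's index formula gives a subgroup of index [N] the rank
    [1 + N (r - 1)]. The [2 N] edges labelled [x1] or [x2] of its coset graph
    each support a cocycle, and those vanishing on [V] form a space of dimension
    at most [N], since they are determined by their values at the [N]
    vertices. *)
Lemma free_homs : exists f : 'I_N -> F -> 'F_p,
  (forall i, hom_on V (f i)) /\ indep V f.
Proof.
have [rhoE rhos] := rhoV.
pose r (i : 'I_N) := sval (cid (rhos (enum_val i))).
have rK i : rho (r i) = enum_val i by rewrite /r; case: cid.
pose at_ (x y : X) : 'F_p := (if `[< x = y >] then 1 else 0)%R.
pose c (s : 'I_(N + N)) (g : F) (x : X) : addgrp 'F_p :=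
  match fintype.split s with
  | inl i => (at_ x x1 * (rho g == enum_val i)%:R)%R
  | inr i => (at_ x x2 * (rho g == enum_val i)%:R)%R
  end.
have [gb _ int] := free_on_presents fb.
have lP s : exists W, primitive b (c s) W by apply: int.
pose l s : F -> 'F_p := sval (cid (lP s)).
have lE s : primitive b (c s) (l s) by rewrite /l; case: cid.
have l1 s : l s 1 = 0%R by have [] := lE s.
have lM s g x : l s (g * b x) = (l s g + c s g x)%R by have [_ ->] := lE s.
have lV s : equivariant V (l s).
  move=> x y Vx; apply: (primitive_shift gb (lE s)) => k z; rewrite /c.
  suff -> : rho (x * k) = rho k by [].
  by apply/rhoE; rewrite mulgK.
pose Z (a : 'rV['F_p]_(N + N)) := forall v, V v -> lin a l v = 0%R.
have [A ZA] : exists A : 'M_(N + N), forall v, Z v <-> (v <= A)%MS.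
  apply: subspace_matrix.
  - by move=> v _; rewrite lin0.
  - by move=> u v Zu Zv w Vw; rewrite linD Zu // Zv // addr0.
  - by move=> k u Zu w Vw; rewrite linZ Zu // mulr0.
have linM a g x : lin a l (g * b x) = (lin a l g + lin a (fun s => c s ^~ x) g)%R.
  by rewrite /lin -big_split; apply: eq_bigr => s _; rewrite lM mulrDr.
pose T : 'M['F_p]_(N + N, N) := (\matrix_(s, i) l s (r i))%R.
have AT : (A :&: kermx T)%MS = 0%R.
  apply/eqP/rowV0P => a; rewrite sub_capmx => /andP[/ZA Za /sub_kermxP aT].
  have a0 g : lin a l g = 0%R.
    have Vg : V (g * (r (enum_rank (rho g)))^-1).
      by apply/rhoE; rewrite rK enum_rankK.
    rewrite -(mulgVK (r (enum_rank (rho g))) g) (lin_equivariant a lV) // Za //.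
    rewrite add0r; have /matrixP/(_ 0%R (enum_rank (rho g))) := aT.
    rewrite !mxE => aT0; rewrite /lin -[RHS]aT0.
    by apply: eq_bigr => s _; rewrite mxE.
  have ac g x : lin a (fun s => c s ^~ x) g = 0%R.
    by have := linM a g x; rewrite !a0 add0r.
  apply/rowP => s; rewrite mxE.
  pose i := match fintype.split s with inl i => i | inr i => i end.
  pose x := match fintype.split s with inl _ => x1 | inr _ => x2 end.
  have := ac (r i) x; rewrite /lin (bigD1 s) //= big1 => [|s' ss'].
    rewrite addr0 {}/i {}/x /c; case: fintype.split => i; rewrite rK eqxx /at_.
      by rewrite asboolT // !mulr1.
    by rewrite asboolT // !mulr1.
  suff -> : c s' (r i) x = 0%R by rewrite mulr0.
  move: ss'; rewrite {}/i {}/x /c -{1}(fintype.splitK s) -{1}(fintype.splitK s').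
  case: (fintype.split s) (fintype.split s') => [i|i] [i'|i'] ne; rewrite rK /at_.
  - rewrite (inj_eq enum_val_inj); case: (i =P i') ne => [->|_ _].
      by rewrite eqxx.
    by rewrite mulr0.
  - by rewrite asboolF ?mul0r.
  - by rewrite asboolF ?mul0r //; apply/nesym.
  - rewrite (inj_eq enum_val_inj); case: (i =P i') ne => [->|_ _].
      by rewrite eqxx.
    by rewrite mulr0.
have rkA : (N <= \rank (A^C)%MS)%N.
  rewrite mxrank_compl leq_subRL ?rank_leq_col // addnC leq_add2l.
  by rewrite -(mxrank_mul_ker A T) AT mxrank0 addn0 rank_leq_col.
have [B fB BA] := row_free_sub rkA.
exists (fun i => lin (row i B) l); split=> [i|a Ba].
  by apply: lin_hom => j; apply/equivariant_hom/lV.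
apply/eqP; rewrite -(mulmx_free_eq0 a fB) -submx0.
rewrite -(capmx_compl A) sub_capmx; apply/andP; split.
  by apply/ZA => v Vv; rewrite lin_mulmx Ba.
exact: submx_trans (submxMl _ _) BA.
Qed.

End FreeHoms.

(** * Pro-p completions *)

Section Completion.
Local Open Scope classical_set_scope.
Local Open Scope quotient_scope.
Local Open Scope group_scope.
Variables (p : nat) (p_pr : prime p).

Section OneGroup.
Variable G : groupType.

Lemma pi_quotg_repr (N : normalSubgroup G) (x : quotg N) :
  \pi_(quotg N) (repr x) = x.
Proof. by rewrite reprK. Qed.

Definition p_index (N : G -> Prop) (nN : p_normal p N) : pindex p G.
Proof.
exists (nsub nN); apply/(ppower_index_p_normal p_pr).
suff -> : (fun x => is_true (x \in nsub nN)) = N by [].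
by apply/funext => x; apply/propext; split=> /(nsubP nN).
Defined.

Lemma p_indexP (N : G -> Prop) (nN : p_normal p N) x :
  reflect (N x) (x \in sval (p_index nN)).
Proof. exact: nsubP. Qed.

Lemma pindex_normal (M : pindex p G) : p_normal p (fun x => x \in sval M).
Proof. by apply/(ppower_index_p_normal p_pr); case: M. Qed.

Lemma pindexI (M N : pindex p G) : exists L : pindex p G,
  {subset sval L <= sval M} /\ {subset sval L <= sval N}.
Proof.
exists (p_index (p_normalI (pindex_normal M) (pindex_normal N))).
by split=> x /p_indexP[].
Qed.

(** The projections to a single quotient already give a basis of
    neighbourhoods, the quotients forming a directed system. *)
Lemma completion_nbhs (w : quotg_prod p G) (O : set (quotg_prod p G)) :
  compatible w -> nbhs w O ->
  exists M : pindex p G, forall w', compatible w' -> w' M = w M -> O w'.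
Proof.
move=> cw.
pose Phi : set_system (quotg_prod p G) := fun S =>
  exists M : pindex p G, forall w', compatible w' -> w' M = w M -> S w'.
have PhiF : Filter Phi.
  split.
  - by exists (p_index (p_normalT p G)).
  - move=> S T [M MS] [N NT]; have [L [LM LN]] := pindexI M N.
    exists L => w' cw' w'L; split.
      by apply: MS => //; rewrite -(cw' _ _ LM) -(cw _ _ LM) w'L.
    by apply: NT => //; rewrite -(cw' _ _ LN) -(cw _ _ LN) w'L.
  - by move=> S T ST [M MS]; exists M => w' cw' w'M; apply/ST/MS.
suff : Phi --> w by apply.
apply/cvg_sup => M S [_ [[B oB <-] Bw BS]].
exists M => w' cw' w'M; apply: BS.
by rewrite /= /preimage /= w'M.
Qed.

Lemma diagonal_compatible (k : G) :
  (fun N : pindex p G => \pi_(quotg (sval N)) k) \in @compatible p G.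
Proof. by rewrite inE => N M NM; apply: quotg_projE. Qed.

Definition diagonal (k : G) : pro_completion p G :=
  exist (fun x : quotg_prod p G => x \in @compatible p G)
    (fun N : pindex p G => \pi_(quotg (sval N)) k) (diagonal_compatible k).

Lemma diagonalM k l : diagonal (k * l) = diagonal k * diagonal l.
Proof.
apply: val_inj; rewrite [RHS]gmulfM; apply/functional_extensionality_dep => N.
exact: pi_quotgM.
Qed.

Lemma completion_compatible (z : pro_completion p G) : compatible (val z).
Proof. by case: z => x /= /set_mem. Qed.

End OneGroup.

Lemma pro_completion_iso_sym (G K : groupType) :
  pro_completion_iso p G K -> pro_completion_iso p K G.
Proof.
move=> [f [g [fK gK cf cg]]].
have gM : {morph g : x y / x * y}.
  by move=> x y; rewrite -{1}(gK x) -{1}(gK y) -gmulfM fK.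
have [g' g'E] := ghom_exists gM.
have e : (g' : _ -> _) = g by apply/funext.
by exists g', f; rewrite e.
Qed.

(** Isomorphic completions make [K] dense in the completion of [G], so it maps
    onto every quotient of [G] of [p]-power order, compatibly. *)
Lemma pro_completion_quotients (G K : groupType) : pro_completion_iso p G K ->
  exists psi : forall M : pindex p G, K -> quotg (sval M),
  [/\ forall M k l, psi M (k * l) = psi M k * psi M l,
      forall (M N : pindex p G) k, {subset sval M <= sval N} ->
        quotg_proj (sval N) (psi M k) = psi N k &
      forall M q, exists k, psi M k = q].
Proof.
move=> [f [g [fK gK cf cg]]].
have gM : {morph g : x y / x * y}.
  by move=> x y; rewrite -{1}(gK x) -{1}(gK y) -gmulfM fK.
exists (fun M k => (val (g (diagonal k)) : quotg_prod p G) M); split.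
- move=> M k l; rewrite diagonalM gM.
  have -> : val (g (diagonal k) * g (diagonal l))
      = val (g (diagonal k)) * val (g (diagonal l)) by exact: gmulfM.
  by [].
- by move=> M N k MN; apply: completion_compatible.
move=> M q.
pose z := f (diagonal (repr q)).
pose U : set (pro_completion p K) := fun y => (val (g y) : quotg_prod p G) M = q.
have zU : nbhs z U.
  have cv : continuous (val : pro_completion p G -> quotg_prod p G).
    exact: initial_continuous.
  have cM : continuous (fun w : quotg_prod p G => w M).
    exact: proj_continuous.
  have qn : nbhs ((val (g z) : quotg_prod p G) M) [set q].
    rewrite /z fK /= pi_quotg_repr nbhs_principalE.
    exact/principal_filterP.
  exact: (cg z _ (cv (g z) _ (cM (val (g z)) _ qn))).
have [_ [[B oB <-] Bz BU]] := zU.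
have Bn : nbhs (val z : quotg_prod p K) B by apply: open_nbhs_nbhs.
have [L LB] := completion_nbhs (completion_compatible z) Bn.
exists (repr ((val z : quotg_prod p K) L)); apply: BU; apply: LB.
  exact: completion_compatible.
exact: pi_quotg_repr.
Qed.

End Completion.

(** * Approximation by a free group *)

(** First-order shadow of a homomorphism from [K0] to the pro-[p] completion of
    [F] with dense image: [sim W k g] says that the image of [k] agrees with [g]
    modulo [W]. *)
Record approximation (p : nat) (K F : groupType) (K0 : K -> Prop)
    (sim : (F -> Prop) -> K -> F -> Prop) : Prop := Approximation {
  sim_dom : forall W k g, sim W k g -> K0 k;
  sim_total : forall W k, p_normal p W -> K0 k -> exists g, sim W k g;
  sim_dense : forall W g, p_normal p W -> exists k, sim W k g;
  simM : forall W k g l h, p_normal p W ->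
    sim W k g -> sim W l h -> sim W (k * l) (g * h);
  simS : forall (W W' : F -> Prop) k g,
    (forall x, W x -> W' x) -> sim W k g -> sim W' k g;
  sim_eq : forall (W : F -> Prop) k g h, p_normal p W ->
    sim W k g -> sim W k h -> W (g^-1 * h);
  sim_trans : forall (W : F -> Prop) k g h, p_normal p W ->
    sim W k g -> W (g^-1 * h) -> sim W k h
}.

Section BuildApproximation.
Local Open Scope quotient_scope.
Local Open Scope group_scope.
Variables (p : nat) (p_pr : prime p) (G K F : groupType).
Variable psi : forall M : pindex p G, K -> quotg (sval M).
Hypotheses (psiM : forall M k l, psi M (k * l) = psi M k * psi M l)
  (psi_proj : forall (M N : pindex p G) k, {subset sval M <= sval N} ->
     quotg_proj (sval N) (psi M k) = psi N k)
  (psi_surj : forall M q, exists k, psi M k = q).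
Variables (N0 : normalSubgroup G) (phi : {ghom subg_of N0 -> F}).
Hypotheses (N0p : ppower_index p N0) (phi_surj : set_surj setT setT phi).

Let M0 : pindex p G := exist _ N0 N0p.

Let phiX (x : G) : F := if insub x is Some u then phi u else 1.

Let phiXM x y : x \in N0 -> y \in N0 -> phiX (x * y) = phiX x * phiX y.
Proof.
move=> Nx Ny; rewrite /phiX !insubT //; first exact: nsM.
move=> Nxy; rewrite -gmulfM; congr (phi _); apply: val_inj.
by rewrite [RHS]gmulfM.
Qed.

Let phiX1 : phiX 1 = 1.
Proof. by apply: (mulgI (phiX 1)); rewrite -phiXM ?ns1 // !mulg1. Qed.

Let phiXV x : x \in N0 -> phiX x^-1 = (phiX x)^-1.
Proof.
move=> Nx; apply: (mulgI (phiX x)).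
by rewrite -phiXM ?nsV // !mulgV phiX1.
Qed.

Let phiXX x n : x \in N0 -> x ^+ n \in N0 /\ phiX (x ^+ n) = phiX x ^+ n.
Proof.
move=> Nx; elim: n => [|n [Nn IH]]; first by rewrite !expg0 ns1 phiX1.
by rewrite !expgS phiXM // IH nsM.
Qed.

Let phiX_surj g : exists2 n, n \in N0 & phiX n = g.
Proof.
have [u _ <-] := phi_surj (I : setT g); exists (val u); first exact: (valP u).
by rewrite /phiX valK.
Qed.

Let sub_phi (W : F -> Prop) (M : pindex p G) :=
  forall x, x \in sval M -> x \in N0 /\ W (phiX x).

(** The preimage of [W] is normal in [N0] only; its core in [G] still has
    [p]-power index. *)
Let sub_phi_ex W : p_normal p W -> exists M, sub_phi W M.
Proof.
move=> nW; have sW : subgroup W by exact: nW.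
have [|||||M nM MA] := @p_normal_core p G (fun x => x \in N0)
    (fun x => x \in N0 /\ W (phiX x)) (pindex_normal p_pr M0).
- split.
  + by rewrite phiX1 ns1; split=> //; apply: sg1.
  + move=> x y [Nx Wx] [Ny Wy]; split; first exact: nsM.
    by rewrite phiXM //; apply: sgM.
  + move=> x [Nx Wx]; split; first exact: nsV.
    by rewrite phiXV //; apply: sgV.
- by move=> x [].
- move=> x y Ny [Nx Wx]; split; first exact: ns_conj.
  rewrite conjgE !phiXM ?phiXV ?nsM ?nsV // -conjgE.
  exact: (normalJ nW).
- have [T [f fW]] := p_normal_fin nW; exists T, (fun x => f (phiX x)).
  move=> x y Nx Ny /(fW _ _ isT isT) Wxy; split; first by apply: nsM => //; apply: nsV.
  by rewrite phiXM ?phiXV // nsV.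
- move=> x Nx; have [j Wj] : exists j, W (phiX x ^+ (p ^ j)%N).
    by apply: (p_normal_tors nW).
  by exists j; have [? ->] := phiXX (p ^ j)%N Nx.
by exists (p_index p_pr nM) => x /p_indexP/MA.
Qed.

Definition base_kernel (k : K) := psi M0 k = 1.

(** [k] and [g] are compared through an element [n] of [N0] that has the image of
    [k] in a quotient of [G] fine enough to determine [phi n] modulo [W]. *)
Definition psi_sim (W : F -> Prop) (k : K) (g : F) :=
  base_kernel k /\ exists2 M, sub_phi W M &
    exists n, [/\ n \in N0, psi M k = \pi_(quotg (sval M)) n
                & W ((phiX n)^-1 * g)].

Let psi1 M : psi M 1 = 1.
Proof. by apply: (mulgI (psi M 1)); rewrite -psiM !mulg1. Qed.

Let sub_base (W : F -> Prop) M : sub_phi W M -> {subset sval M <= sval M0}.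
Proof. by move=> sM x /sM[]. Qed.

Let base_mem W M k n : sub_phi W M ->
  psi M k = \pi_(quotg (sval M)) n -> (base_kernel k <-> n \in N0).
Proof.
move=> sM kn; rewrite /base_kernel -(psi_proj k (sub_base sM)) kn.
rewrite quotg_projE; last exact: (sub_base sM).
split=> [/esym/quotgP|nN]; first by rewrite invg1 mul1g.
by apply/esym/quotgP; rewrite invg1 mul1g.
Qed.

(** Refining witnesses lets two of them be compared in a common quotient of [G]. *)
Let sim_refine W (M L : pindex p G) k g : subgroup W -> sub_phi W M ->
  {subset sval L <= sval M} -> forall n, n \in N0 ->
  psi M k = \pi_(quotg (sval M)) n -> W ((phiX n)^-1 * g) ->
  exists l, [/\ l \in N0, psi L k = \pi_(quotg (sval L)) l
              & W ((phiX l)^-1 * g)].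
Proof.
move=> sW sM LM n Nn kn Wg; pose l := repr (psi L k).
have kl : psi L k = \pi_(quotg (sval L)) l by rewrite pi_quotg_repr.
have /quotgP nl : \pi_(quotg (sval M)) n = \pi_(quotg (sval M)) l.
  by rewrite -kn -(quotg_projE _ LM) -kl psi_proj.
have [Nnl Wnl] := sM _ nl.
have Nl : l \in N0 by rewrite -(mulVKg n l); apply: nsM.
exists l; split=> //.
rewrite phiXM ?phiXV ?nsV // in Wnl.
by have := sgM sW (sgV sW Wnl) Wg; rewrite invgM invgK mulgA mulgK.
Qed.

Lemma psi_approximation : approximation p base_kernel psi_sim.
Proof.
split.
- by move=> W k g [].
- move=> W k nW k0; have [M sM] := sub_phi_ex nW.
  pose n := repr (psi M k).
  have kn : psi M k = \pi_(quotg (sval M)) n by rewrite pi_quotg_repr.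
  exists (phiX n); split=> //; exists M => //; exists n; split=> //.
    exact/(base_mem sM kn).
  by rewrite mulVg; apply: (sg1 nW).
- move=> W g nW; have [M sM] := sub_phi_ex nW.
  have [n Nn ng] := phiX_surj g.
  have [k kn] := psi_surj (\pi_(quotg (sval M)) n).
  exists k; split; first exact/(base_mem sM kn).
  exists M => //; exists n; split=> //.
  by rewrite ng mulVg; apply: (sg1 nW).
- move=> W k g l h nW [k0 [M sM [m [Nm km Wm]]]] [l0 [N sN [n [Nn ln Wn]]]].
  have [L [LM LN]] := pindexI p_pr M N.
  have sW : subgroup W by exact: nW.
  have [a [Na ka Wa]] := sim_refine sW sM LM Nm km Wm.
  have [b [Nb lb Wb]] := sim_refine sW sN LN Nn ln Wn.
  have sL : sub_phi W L by move=> x /LM/sM.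
  split; first by rewrite /base_kernel psiM k0 l0 mulg1.
  exists L => //; exists (a * b); split; first exact: nsM.
    by rewrite psiM ka lb pi_quotgM.
  have := sgM sW (normalJ nW (phiX b) Wa) Wb.
  by rewrite phiXM // invgM conjgE !mulgA mulgK.
- move=> W W' k g WW' [k0 [M sM [n [Nn kn Wn]]]]; split=> //.
  exists M; first by move=> x /sM[? ?]; split=> //; apply: WW'.
  by exists n; split=> //; apply: WW'.
- move=> W k g h nW [k0 [M sM [m [Nm km Wm]]]] [_ [N sN [n [Nn kn Wn]]]].
  have [L [LM LN]] := pindexI p_pr M N.
  have sW : subgroup W by exact: nW.
  have [a [Na ka Wa]] := sim_refine sW sM LM Nm km Wm.
  have [b [Nb kb Wb]] := sim_refine sW sN LN Nn kn Wn.
  have /quotgP ab : \pi_(quotg (sval L)) a = \pi_(quotg (sval L)) b.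
    by rewrite -ka -kb.
  have [_] := sM _ (LM _ ab).
  rewrite phiXM ?phiXV ?nsV // => Wab.
  have := sgM sW (sgM sW (sgV sW Wa) Wab) Wb.
  by rewrite invgM invgK !mulgA mulgK mulgK.
move=> W k g h nW [k0 [M sM [n [Nn kn Wn]]]] Wgh; split=> //.
exists M => //; exists n; split=> //.
have sW : subgroup W by exact: nW.
by have := sgM sW Wn Wgh; rewrite mulgA mulgK.
Qed.

Lemma base_kernel_p_normal : p_normal p base_kernel.
Proof.
have [nM [T [f fE]] tors] := pindex_normal p_pr M0.
have psiV k : psi M0 k^-1 = (psi M0 k)^-1.
  by apply: (mulgI (psi M0 k)); rewrite -psiM !mulgV psi1.
have psiX k n : psi M0 (k ^+ n) = psi M0 k ^+ n.
  by elim: n => [|n IH]; rewrite ?expg0 // !expgS psiM IH.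
split.
- split; first split.
  + exact: psi1.
  + by move=> x y; rewrite /base_kernel psiM => -> ->; rewrite mulg1.
  + by move=> x; rewrite /base_kernel psiV => ->; rewrite invg1.
  + move=> x y; rewrite /base_kernel conjgE !psiM psiV => ->.
    by rewrite mul1g mulVg.
- exists T, (fun k => f (repr (psi M0 k))) => x y _ _ /fE => /(_ isT isT)/quotgP.
  by rewrite !pi_quotg_repr /base_kernel psiM psiV => ->; rewrite mulVg.
move=> k _; have [j] := tors (repr (psi M0 k)) isT.
set n := repr _ => nj; exists j; rewrite /base_kernel psiX.
rewrite -(pi_quotg_repr (psi M0 k)) -/n.
have -> : (\pi_(quotg (sval M0)) n) ^+ (p ^ j)%N
    = \pi_(quotg (sval M0)) (n ^+ (p ^ j)%N).
  by elim: (p ^ j)%N => [|i IH]; rewrite ?expg0 // !expgS pi_quotgM IH.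
by apply/esym/quotgP; rewrite invg1 mul1g.
Qed.

End BuildApproximation.

(** * The tower of levels *)

Definition covers (K : groupType) (H : K -> Prop) (cs : seq K) :=
  forall k, exists2 t, t \in cs & H (k * t^-1).

Section Levels.
Variables (p : nat) (p_pr : prime p) (K F : groupType).
Variables (K0 : K -> Prop) (sim : (F -> Prop) -> K -> F -> Prop).
Hypotheses (K0n : p_normal p K0) (app : approximation p K0 sim).
Variables (X : Type) (b : X -> F) (x1 x2 : X).
Hypotheses (fb : free_on b) (x12 : x1 <> x2).

Lemma sim1 W : p_normal p W -> sim W 1 1.
Proof.
move=> nW; have [g g1] := sim_total app nW (sg1 K0n).
have gg := simM app nW g1 g1; rewrite mulg1 in gg.
have := sim_eq app nW g1 gg; rewrite mulKg => Wg.
by apply: (sim_trans app nW g1); rewrite mulg1; apply: (sgV nW).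
Qed.

Lemma simV W k g : p_normal p W -> sim W k g -> sim W k^-1 g^-1.
Proof.
move=> nW kg; have [h kh] := sim_total app nW (sgV K0n (sim_dom app kg)).
have := simM app nW kg kh; rewrite mulgV => gh.
apply: (sim_trans app nW kh); rewrite -invgM.
by have := sim_eq app nW gh (sim1 nW); rewrite mulg1.
Qed.

(** [H] is the preimage in [K0] of the closure of [V] in the pro-[p] completion
    of [F]. *)
Definition matches (V : F -> Prop) (H : K -> Prop) := forall k, H k <->
  exists W, [/\ p_normal p W, forall x, W x -> V x & exists2 g, V g & sim W k g].

Lemma matches_sim V H W k g : subgroup V -> matches V H -> p_normal p W ->
  (forall x, W x -> V x) -> sim W k g -> (H k <-> V g).
Proof.
move=> sV VH nW WV kg; split; last first.
  by move=> Vg; apply/VH; exists W; split=> //; exists g.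
case/VH=> W' [nW' WV' [g' Vg' kg']].
have nI := p_normalI nW nW'.
have [h kh] := sim_total app nI (sim_dom app kg).
have gh := sim_eq app nW kg (simS app (fun x (Ix : W x /\ W' x) => Ix.1) kh).
have g'h := sim_eq app nW' kg' (simS app (fun x (Ix : W x /\ W' x) => Ix.2) kh).
have Vh : V h by rewrite -(mulVKg g' h); apply: sgM => //; apply: WV'.
by apply: (sgMr sV (WV _ gh)); rewrite mulVKg.
Qed.

(** A level of the tower of subgroups of [K]. Its index [N] measured in [F]
    controls both the number of its cosets in [K] ([level_covers]) and, from
    below, the rank of its homology modulo [p] ([level_homs]). *)
Definition level (N : nat) (H : K -> Prop) := exists V : F -> Prop,
  [/\ subgroup V, p_open p V, matches V H &
      exists (R : finType) (rho : F -> R), #|R| = N /\ index_by V rho].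

Lemma level_base : level 1 K0.
Proof.
exists (fun=> True); split.
- by split.
- by exists (fun=> True) => //; apply: p_normalT.
- move=> k; split=> [k0|[W [_ _ [g _ /(sim_dom app)]]]] //.
  have nT := p_normalT p F; have [g kg] := sim_total app nT k0.
  by exists (fun=> True); split=> //; exists g.
exists unit, (fun=> tt); rewrite card_unit; split=> //; split=> //.
by case; exists 1.
Qed.

Lemma level_subgroup N H : level N H -> subgroup H.
Proof.
move=> [V [sV [W nW WV] VH _]].
have HV k g := matches_sim sV VH nW WV (k := k) (g := g).
have HK0 k : H k -> K0 k by case/VH=> W' [_ _ [g _ /(sim_dom app)]].
split.
- by apply/(HV _ _ (sim1 nW)); apply: (sg1 sV).
- move=> k l Hk Hl.
  have [g kg] := sim_total app nW (HK0 _ Hk).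
  have [h lh] := sim_total app nW (HK0 _ Hl).
  apply/(HV _ _ (simM app nW kg lh)); apply: (sgM sV).
    exact/(HV _ _ kg).
  exact/(HV _ _ lh).
- move=> k Hk; have [g kg] := sim_total app nW (HK0 _ Hk).
  apply/(HV _ _ (simV nW kg)); apply: (sgV sV).
  exact/(HV _ _ kg).
Qed.

Lemma level_open N H : level N H -> p_open p H.
Proof.
move=> [V [sV [W nW WV] VH _]].
have HV k g := matches_sim sV VH nW WV (k := k) (g := g).
have [|||||M nM MA] := @p_normal_core p K K0 (fun k => sim W k 1) K0n.
- split; first exact: sim1.
  + by move=> k l k1 l1; have := simM app nW k1 l1; rewrite mulg1.
  + by move=> k k1; have := simV nW k1; rewrite invg1.
- by move=> k /(sim_dom app).
- move=> k y /(sim_total app nW)[h yh] k1.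
  have := simM app nW (simV nW yh) (simM app nW k1 yh).
  by rewrite mul1g mulVg.
- pose gk k := if pselect (exists g, sim W k g) is left e
    then sval (cid e) else 1.
  have gkP k : K0 k -> sim W k (gk k).
    move=> /(sim_total app nW) e; rewrite /gk.
    by case: pselect => [e'|//]; case: cid.
  have [T [f fW]] := p_normal_fin nW.
  exists T, (fun k => f (gk k)) => k l /gkP kg /gkP lg /(fW _ _ isT isT) Wkl.
  apply: (sim_trans app nW (simM app nW (simV nW kg) lg)).
  by rewrite mulg1; apply: (sgV nW).
- move=> k /(sim_total app nW)[g kg].
  have [j Wj] : exists j, W (g ^+ (p ^ j)%N) by apply: (p_normal_tors nW).
  exists j; have kX n : sim W (k ^+ n) (g ^+ n).
    elim: n => [|n IH]; first by rewrite !expg0; apply: sim1.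
    by rewrite !expgS; apply: (simM app).
  by apply: (sim_trans app nW (kX _)); rewrite mulg1; apply: (sgV nW).
by exists M => // k /MA k1; apply/(HV _ _ k1); apply: (sg1 sV).
Qed.

Lemma p_normal_covers (G : groupType) (N : G -> Prop) :
  p_normal p N -> exists cs, covers N cs.
Proof.
move=> [nN [T [f fN]] _].
pose r t := if pselect (exists k, f k = t) is left e then sval (cid e) else 1.
exists [seq (r t)^-1 | t <- enum T] => k.
exists (r (f k^-1))^-1; first by apply/mapP; exists (f k^-1); rewrite ?mem_enum.
rewrite invgK; have := fN (k^-1) (r (f k^-1)) isT isT.
rewrite invgK; apply; rewrite /r; case: pselect => [e|]; first by case: cid.
by case; exists k^-1.
Qed.

Lemma level_covers cs : covers K0 cs -> forall N H, level N H ->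
  exists2 ts, size ts = (size cs * N)%N & covers H ts.
Proof.
move=> cK N H [V [sV [W nW WV] VH [R [rho [<- [rhoE rhos]]]]]].
have HV k g := matches_sim sV VH nW WV (k := k) (g := g).
pose r i := sval (cid (rhos i)).
have rK i : rho (r i) = i by rewrite /r; case: cid.
pose s i := sval (cid (sim_dense app (r i) nW)).
have sr i : sim W (s i) (r i) by rewrite /s; case: cid.
exists [seq s i * c | c <- cs, i <- enum R].
  by rewrite size_allpairs -cardE.
move=> k; have [c cscs kc] := cK k.
have [g kg] := sim_total app nW kc.
exists (s (rho g) * c); first by apply: allpairs_f; rewrite ?mem_enum.
rewrite invgM mulgA.
apply/(HV _ _ (simM app nW kg (simV nW (sr (rho g))))).
by apply/rhoE; rewrite rK.
Qed.

(** The homomorphisms of [free_homs] are invariant under some [W] of [p]-power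
    index, so their values can be read off from approximations modulo [W]. *)
Lemma level_homs N H : level N H -> exists f : 'I_N -> K -> 'F_p,
  [/\ forall i, hom_on H (f i), indep H f &
      forall d (B : 'M_(d, N)), row_free B ->
        level (N * p ^ d) (joint_ker H (fun i => lin (row i B) f))].
Proof.
move=> lH; have sH := level_subgroup lH.
case: lH => [V [sV oV VH [R [rho [<- rhoV]]]]].
have [l [lV li]] := free_homs p fb x12 rhoV.
have [W nW WV'] := joint_ker_open p_pr sV lV oV.
have WV x : W x -> V x by case/WV'.
have Wl x i : W x -> l i x = 0%R by case/WV'.
have HV k g := matches_sim sV VH nW WV (k := k) (g := g).
have HK0 k : H k -> K0 k by case/VH=> W' [_ _ [g _ /(sim_dom app)]].
pose gk k := if pselect (exists g, sim W k g) is left e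
  then sval (cid e) else 1.
have gkP k : K0 k -> sim W k (gk k).
  move=> /(sim_total app nW) e; rewrite /gk.
  by case: pselect => [e'|//]; case: cid.
have lW i g w : V g -> W w -> l i (g * w) = l i g.
  move=> Vg Ww; rewrite lV //; last exact: WV.
  by rewrite (Wl w) // addr0.
have lgk i k g : H k -> sim W k g -> l i (gk k) = l i g.
  move=> Hk kg; have Vg := (HV _ _ kg).1 Hk.
  rewrite -(mulVKg g (gk k)) lW //.
  by apply: (sim_eq app nW kg); apply/gkP/HK0.
have lkg i k g : V g -> sim W k g -> l i (gk k) = l i g.
  by move=> Vg kg; apply: lgk => //; apply/(HV _ _ kg).
have fH i : hom_on H (fun k => l i (gk k)).
  move=> h k Hh Hk; have hg := gkP _ (HK0 _ Hh); have kg := gkP _ (HK0 _ Hk).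
  rewrite (lgk i _ _ (sgM sH Hh Hk) (simM app nW hg kg)) lV //.
    exact/(HV _ _ hg).
  exact/(HV _ _ kg).
exists (fun i k => l i (gk k)); split=> //.
  move=> a a0; apply: li => v Vv; have [k kv] := sim_dense app v nW.
  have Hk : H k by apply/(HV _ _ kv).
  rewrite -[RHS](a0 k Hk); apply: eq_bigr => i _.
  by rewrite (lgk i _ _ Hk kv).
move=> d B fB.
have BV i : hom_on V (lin (row i B) l) by apply: lin_hom.
have Bi : indep V (fun i => lin (row i B) l) by apply: indep_row_free.
have lin_gk i k g : H k -> sim W k g ->
    lin (row i B) (fun i k => l i (gk k)) k = lin (row i B) l g.
  by move=> Hk kg; apply: eq_bigr => j _; rewrite (lgk j _ _ Hk kg).
exists (joint_ker V (fun i => lin (row i B) l)); split.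
- exact: joint_ker_subgroup.
- exact: joint_ker_open.
- move=> k; split=> [[Hk fk]|[W' [nW' W'V [g [Vg lg] kg]]]].
    have kg := gkP _ (HK0 _ Hk).
    exists W; split=> //.
      move=> x Wx; split; first exact: WV.
      by move=> i; rewrite /lin big1 // => j _; rewrite Wl ?mulr0.
    exists (gk k) => //; split; first exact/(HV _ _ kg).
    by move=> i; rewrite -(lin_gk _ _ _ Hk kg).
  have W'V1 x : W' x -> V x by case/W'V.
  have Hk : H k by apply/(matches_sim sV VH nW' W'V1 kg).
  split=> // i.
  have nI := p_normalI nW nW'.
  have [h kh] := sim_total app nI (sim_dom app kg).
  have khW := simS app (fun x (Ix : W x /\ W' x) => Ix.1) kh.
  have := sim_eq app nW' kg (simS app (fun x (Ix : W x /\ W' x) => Ix.2) kh).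
  move=> /W'V[Vgh lgh]; rewrite (lin_gk _ _ _ Hk khW) -(mulVKg g h).
  by rewrite BV // lg lgh addr0.
have [rho' rhoV'] := index_joint_ker sV rhoV BV Bi.
exists (R * 'rV['F_p]_d)%type, rho'; split=> //.
by rewrite card_prod card_mx mul1n card_Fp.
Qed.

End Levels.

(** * Cup products *)

Lemma telescope_add (V : zmodType) (a s x y z : V) :
  ((a + (y - x)) + (s + (z - y)) = (a + s) + (z - x))%R.
Proof. by rewrite addrACA; congr (_ + _)%R; rewrite addrC addrA subrK. Qed.

Lemma shift_cancel (V : zmodType) (q c e' e g : V) :
  (q + (c + (e' - e)) - g - e' = q - g - e + c)%R.
Proof. by rewrite !addrA (ACl (1*5*4*2*3*6)) /= addrK. Qed.

Section CupProducts.
Variables (p : nat) (p_pr : prime p) (X : Type) (K : groupType) (b : X -> K).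
Variable rels : seq (seq (X * bool)).
Hypothesis pres : presents b rels.

Let gb : generates b. Proof. by case: pres. Qed.

Lemma path_prod_shift (A : groupType) (c : K -> X -> A) h k w :
  path_prod b c (h * k) w = path_prod b (fun k x => c (h * k) x) k w.
Proof.
elim: w k => [|[x s] w IH] k //=; rewrite -mulgA IH; congr (_ * _).
by rewrite /letter_step /=; case: s; rewrite ?mulgA.
Qed.

Lemma path_prod_cobound (c c' : K -> X -> addgrp 'F_p) (E : K -> 'F_p) k w :
  (forall k x, c' k x = c k x + (E (k * b x)%g - E k) :> 'F_p)%R ->
  path_prod b c' k w = (path_prod b c k w + (E (k * word_val b w)%g - E k) : 'F_p)%R.
Proof.
move=> c'E; elim: w k => [|[x s] w IH] k /=.
  by rewrite mulg1 !addgrp1 subrr addr0.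
rewrite !addgrpM IH mulgA /letter_step /letter_val; case: s => /=.
  by rewrite c'E telescope_add.
by rewrite !addgrpV c'E mulgVK opprD opprB telescope_add.
Qed.

Lemma path_prod_lin D (a : 'rV['F_p]_D) (c : 'I_D -> K -> X -> addgrp 'F_p) k w :
  path_prod b (fun k x => lin a (fun s => c s ^~ x) k : addgrp 'F_p) k w
    = lin a (fun s k => path_prod b (c s) k w : 'F_p) k.
Proof.
elim: w k => [|[x s] w IH] k /=.
  by rewrite /lin big1 // => i _; rewrite addgrp1 mulr0.
rewrite addgrpM IH /lin -[in LHS](addr0 (bigop _ _ _)) addr0.
rewrite /letter_step; case: s => /=.
  by rewrite -big_split; apply: eq_bigr => i _; rewrite addgrpM mulrDr.
rewrite addgrpV /lin -sumrN -big_split; apply: eq_bigr => i _.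
by rewrite addgrpM addgrpV mulrDr mulrN.
Qed.

Variables (H : K -> Prop) (d u : nat).
Variables (l : 'I_d -> K -> 'F_p) (U : 'I_u -> K -> 'F_p).
Hypotheses (sH : subgroup H) (lH : forall i, equivariant H (l i))
  (UH : forall i, equivariant H (U i)).
Hypothesis lU_surj : forall (e : 'I_d -> 'F_p) (e' : 'I_u -> 'F_p),
  exists h, [/\ H h, forall i, l i h = e i & forall i, U i h = e' i].

Local Notation S := ('I_d * 'I_u)%type.
Let cup (s : S) (k : K) (x : X) : 'F_p :=
  (l s.1 k * (U s.2 (k * b x)%g - U s.2 k))%R.

Let cup_shift s h k x : H h ->
  (cup s (h * k)%g x
    = cup s k x + (l s.1 h * U s.2 (k * b x)%g - l s.1 h * U s.2 k))%R.
Proof.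
move=> Hh; rewrite /cup -mulgA lH // (UH _ (k * b x) Hh) (UH _ k Hh).
rewrite opprD addrACA subrr add0r.
by rewrite -mulrBr -mulrDl; congr (_ * _)%R; rewrite addrC.
Qed.

Local Notation D := #|{: S}|.
Let ccup (s : 'I_D) := cup (enum_val s).

(** If [l] and [U] are jointly independent, the cup products of the [l j] with
    the [U m] are so independent on the common kernel [H'] of the [l j] that no
    combination of them is a coboundary there: translating a primitive by
    [g] in [H] changes it by a combination of the [U m] with coefficients
    [l j g], which [H'] detects.  A combination is a cocycle on the Cayley
    complex as soon as its sums round one translate of each relator per coset of
    [H] vanish. *)
Lemma cup_product_cocycles e ts : covers H ts ->
  (size ts * size rels + e <= d * u)%N ->
  exists W : 'I_e -> K -> 'F_p,
  [/\ forall i, equivariant (joint_ker H l) (W i),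
      indep (joint_ker H l) W &
      forall i k x, (forall m, U m (k * b x) = U m k) -> W i (k * b x) = W i k].
Proof.
move=> cov size_ts; have [_ rel1 int] := pres.
pose T := [seq (t, i) | t <- ts, i <- iota 0 (size rels)].
pose phi (ti : K * nat) s : 'F_p :=
  path_prod b (ccup s : K -> X -> addgrp 'F_p) ti.1 (nth [::] rels ti.2).
have sizeT : (size T + e <= D)%N.
  by rewrite size_allpairs size_iota card_prod !card_ord.
have [B fB BT] := homogeneous_solutions phi sizeT.
pose C (a : 'rV['F_p]_D) k x : 'F_p := lin a (fun s => ccup s ^~ x) k.
pose E (a : 'rV['F_p]_D) h k : 'F_p :=
  (\sum_s a 0 s * (l (enum_val s).1 h * U (enum_val s).2 k))%R.
have Cshift a h k x : H h -> (C a (h * k)%g x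
    = C a k x + (E a h (k * b x)%g - E a h k))%R.
  move=> Hh; rewrite /C /E /lin -sumrB -big_split; apply: eq_bigr => s _.
  by rewrite [ccup s _ _]cup_shift // mulrDr mulrBr.
have Crel i k j : (j < size rels)%N ->
    path_prod b (C (row i B) : K -> X -> addgrp 'F_p) k (nth [::] rels j) = 1.
  move=> jlt; have [t tts kt] := cov k.
  rewrite -(mulgVK t k) path_prod_shift.
  rewrite (@path_prod_cobound (C (row i B)) _ (E (row i B) (k * t^-1))); last first.
    by move=> k' x; apply: Cshift.
  rewrite rel1 // mulg1 subrr addr0 path_prod_lin.
  have := BT (t, j) i; rewrite allpairs_f ?mem_iota // => /(_ isT) BT0.
  rewrite addgrp1 -[RHS]BT0; apply: eq_bigr => s _; by rewrite mxE.
have WP i : exists W, primitive b (C (row i B) : K -> X -> addgrp 'F_p) W.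
  by apply: int => k j; apply: Crel.
pose W i : K -> 'F_p := sval (cid (WP i)).
have WE i : primitive b (C (row i B) : K -> X -> addgrp 'F_p) (W i).
  by rewrite /W; case: cid.
have WH i : equivariant (joint_ker H l) (W i).
  move=> h k [Hh lh]; apply: (primitive_shift gb (WE i)) => k' x.
  rewrite Cshift // /E -sumrB big1 ?addr0 // => s _.
  by rewrite lh !mul0r subrr.
have sH' : subgroup (joint_ker H l).
  by apply: joint_ker_subgroup => // i; apply: equivariant_hom.
have U1 m : U m 1 = 0%R by apply: (hom_on1 sH); apply: equivariant_hom.
exists W; split=> // [a a0 | i k x Uk]; last first.
  have [_ ->] := WE i; rewrite addgrpM /C /lin big1 ?addr0 // => s _.
  by rewrite /ccup /cup Uk subrr !mulr0.
pose A := (a *m B)%R.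
suff A0 : A = 0%R by apply/eqP; rewrite -(mulmx_free_eq0 a fB); apply/eqP.
pose Q : K -> 'F_p := lin a W.
have QE : primitive b (C A : K -> X -> addgrp 'F_p) Q.
  split; first by rewrite /Q /lin big1 // => i _; have [-> _] := WE i; rewrite mulr0.
  move=> k x; rewrite addgrpM /C /A lin_mulmx /Q /lin -big_split.
  by apply: eq_bigr => i _; have [_ ->] := WE i; rewrite addgrpM mulrDr.
have Qshift g k : H g -> (Q (g * k)%g = Q g + Q k + E A g k)%R.
  move=> Hg.
  have E1 : E A g 1 = 0%R by rewrite /E big1 // => s _; rewrite U1 !mulr0.
  have [Q1 QM] := QE.
  have Q2 : primitive b (C A : K -> X -> addgrp 'F_p)
      (fun k => (Q (g * k)%g - Q g - E A g k)%R).
    split; first by rewrite mulg1 subrr E1 subr0.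
    move=> k' x; rewrite mulgA QM !addgrpM Cshift //.
    exact: shift_cancel.
  have := primitive_eq gb Q2 QE k => <-.
  by rewrite -addrA subrK addrC subrK.
apply/rowP => s; rewrite [RHS]mxE.
have [g [Hg gl _]] := lU_surj (fun j => (j == (enum_val s).1)%:R%R) (fun=> 0%R).
have [h [Hh hl hU]] := lU_surj (fun=> 0%R) (fun m => (m == (enum_val s).2)%:R%R).
have H'h : joint_ker H l h by [].
have H'gh : joint_ker H l (g * h * g^-1).
  split=> [|j]; first by apply: (sgM sH); [apply: (sgM sH) | apply: (sgV sH)].
  have lj := equivariant_hom (lH j).
  rewrite lj ?lj ?(hom_onV sH lj) ?hl ?addr0 ?subrr //; last exact: (sgV sH).
  exact: (sgM sH).
have Q0 h' : joint_ker H l h' -> Q h' = 0%R by apply: a0.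
have QH k h' : joint_ker H l h' -> Q (h' * k) = Q k.
  by move=> H'h'; rewrite /Q (lin_equivariant a WH) // -/(Q h') Q0 // add0r.
have := Qshift g h Hg; rewrite (Q0 h) // addr0.
rewrite -[g * h](mulgVK g) (QH g) // => /eqP.
rewrite -[X in X == _]addr0 (inj_eq (addrI _)) eq_sym => /eqP.
rewrite /E (bigD1 s) //= big1 => [|s' ss'].
  by rewrite gl hU !eqxx !mulr1 addr0.
rewrite gl hU; have : enum_val s' != enum_val s by rewrite (inj_eq enum_val_inj).
case: (enum_val s') (enum_val s) => [j m] [j0 m0] /=.
rewrite xpair_eqE negb_and => /orP[/negPf->|/negPf->]; first by rewrite mul0r mulr0.
by rewrite !mulr0.
Qed.

End CupProducts.

(** * Descent of supports *)

Section Descent.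
Variables (p : nat) (p_pr : prime p) (n : nat) (K F : groupType).
Variables (b : 'I_n -> K) (rels : seq (seq ('I_n * bool))).
Hypothesis pres : presents b rels.
Variables (K0 : K -> Prop) (sim : (F -> Prop) -> K -> F -> Prop).
Hypotheses (K0n : p_normal p K0) (app : approximation p K0 sim).
Variables (X : Type) (c : X -> F) (x1 x2 : X).
Hypotheses (fc : free_on c) (x12 : x1 <> x2).
Variable cs : seq K.
Hypothesis cov0 : covers K0 cs.

Local Notation level := (level p sim).

(** [E] bounds the support of the cocycles [U m] modulo [H] from above: it may
    list superfluous edges. *)
Definition supported (H : K -> Prop) u (U : 'I_u -> K -> 'F_p)
    (E : seq (K * 'I_n)) :=
  forall k x m, U m (k * b x) <> U m k ->
    exists2 e, e \in E & e.2 = x /\ H (k * e.1^-1).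

Record stage u N (H : K -> Prop) (U : 'I_u -> K -> 'F_p)
    (E : seq (K * 'I_n)) : Prop := Stage {
  stage_level : level N H;
  stage_equivariant : forall m, equivariant H (U m);
  stage_indep : indep H U;
  stage_support : supported H U E
}.

Lemma equivariant_extensions (H : K -> Prop) D (f : 'I_D -> K -> 'F_p) :
  subgroup H -> (forall i, hom_on H (f i)) ->
  exists f' : 'I_D -> K -> 'F_p, (forall i, equivariant H (f' i)) /\
    forall i h, H h -> f' i h = f i h.
Proof.
move=> sH fH.
have ex i : exists f', equivariant H f' /\ forall h, H h -> f' h = f i h.
  by have [f' ? ?] := equivariant_extension sH (fH i); exists f'.
by exists (fun i => sval (cid (ex i))); split=> i; case: cid => f' [].
Qed.

Lemma eq_in_indep (H : K -> Prop) D (f f' : 'I_D -> K -> 'F_p) :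
  (forall i h, H h -> f' i h = f i h) -> indep H f -> indep H f'.
Proof.
move=> ff fi a a0; apply: fi => h Hh; rewrite -[RHS](a0 h Hh).
by apply: eq_bigr => i _; rewrite ff.
Qed.

Lemma eq_in_joint_ker (H : K -> Prop) d D (B : 'M_(d, D))
    (f f' : 'I_D -> K -> 'F_p) :
  (forall i h, H h -> f' i h = f i h) ->
  joint_ker H (fun i => lin (row i B) f)
  = joint_ker H (fun i => lin (row i B) f').
Proof.
move=> ff; apply/funext => k; apply/propext.
by split=> -[Hk fk]; split=> // i; rewrite -[RHS](fk i);
  apply: eq_bigr => j _; rewrite ff.
Qed.

(** The [l j] chosen to vanish at points dual to the [U m] are independent from
    the [U m], at the cost of [u] dimensions. *)
Lemma independent_complement (H : K -> Prop) u N (U : 'I_u -> K -> 'F_p)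
    (f : 'I_N -> K -> 'F_p) : subgroup H -> (u <= N)%N ->
  (forall i, equivariant H (U i)) -> (forall i, equivariant H (f i)) ->
  indep H U -> indep H f ->
  exists2 B : 'M_(N - u, N), row_free B &
  forall (e : 'I_(N - u) -> 'F_p) (e' : 'I_u -> 'F_p), exists h,
    [/\ H h, forall i, lin (row i B) f h = e i & forall i, U i h = e' i].
Proof.
move=> sH uN UH fH Ui fi.
have hP m := indep_surj sH (fun i => equivariant_hom (UH i)) Ui
  (fun i => (i == m)%:R%R).
pose h m := s2val (cid2 (hP m)).
have Hh m : H (h m) by rewrite /h; case: cid2.
have Uh i m : U i (h m) = (i == m)%:R%R by rewrite /h; case: cid2.
have [|B fB Bh] := @homogeneous_solutions _ _ N (N - u)
    (fun m j => f j (h m)) (enum 'I_u).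
  by rewrite size_enum_ord subnKC.
exists B => //.
pose l i := lin (row i B) f.
have lH i : equivariant H (l i) by apply: lin_equivariant.
have lh i m : l i (h m) = 0%R.
  rewrite -[RHS](Bh m i) ?mem_enum //.
  by apply: eq_bigr => j _; rewrite mxE.
pose lU (s : 'I_(N - u + u)) :=
  match fintype.split s with inl i => l i | inr m => U m end.
have lUH s : hom_on H (lU s).
  by rewrite /lU; case: fintype.split => i; apply: equivariant_hom.
have lUl i : lU (lshift u i) = l i by rewrite /lU -[lshift u i]/(unsplit (inl i)) unsplitK.
have lUr i : lU (rshift (N - u) i) = U i.
  by rewrite /lU -[rshift _ i]/(unsplit (inr i)) unsplitK.
have lUi : indep H lU.
  move=> a a0; rewrite -[a]hsubmxK.
  have aE k : lin a lU k = (lin (lsubmx a) l k + lin (rsubmx a) U k)%R.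
    rewrite /lin big_split_ord /=.
    by congr (_ + _)%R; apply: eq_bigr => i _; rewrite mxE ?lUl ?lUr.
  have r0 : rsubmx a = 0%R.
    apply/rowP => m; rewrite [RHS]mxE -[RHS](a0 _ (Hh m)) aE.
    rewrite {1}/lin big1 => [|i _]; last by rewrite lh mulr0.
    rewrite add0r /lin (bigD1 m) //= Uh eqxx mulr1 big1 ?addr0 // => i im.
    by rewrite Uh (negPf im) mulr0.
  rewrite r0; have -> : lsubmx a = 0%R; last by rewrite row_mx0.
  apply: (indep_row_free fB fi) => k Hk; rewrite -[RHS](a0 k Hk) aE r0.
  by rewrite lin0 addr0.
move=> e e'.
have [k Hk kE] := indep_surj sH lUH lUi
  (fun s => match fintype.split s with inl i => e i | inr m => e' m end).
exists k; split=> // i.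
  by rewrite -/(l i k) -lUl kE -[lshift u i]/(unsplit (inl i)) unsplitK.
by rewrite -lUr kE -[rshift _ i]/(unsplit (inr i)) unsplitK.
Qed.

(** One step down the tower. The cup products live on the old support, lifted
    to the new level; among [u + 1] of them, some [u]-dimensional space
    vanishes on a fraction of the support bounded below independently of the
    level. *)
Lemma stage_step u N H (U : 'I_u -> K -> 'F_p) E : stage N H U E ->
  (u <= N)%N ->
  (size cs * N * size rels + u.+1 <= (N - u) * u)%N ->
  exists d H' (U' : 'I_u -> K -> 'F_p) E', stage (N * p ^ d) H' U' E' /\
    (size E' * p ^ u.+1 <= (p ^ u.+1).-1 * (size E * p ^ d))%N.
Proof.
case=> lvl UH Ui supp uN ineq.
have sH := level_subgroup K0n app lvl.
have [f0 [f0H f0i f0lvl]] := level_homs p_pr K0n app fc x12 lvl.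
have [f [fH ff0]] := equivariant_extensions sH f0H.
have fi : indep H f := eq_in_indep ff0 f0i.
have [B fB lU] := independent_complement sH uN UH fH Ui fi.
have [ts sts cts] := level_covers K0n app cov0 lvl.
rewrite -sts in ineq.
set d := (N - u)%N in B fB lU ineq.
pose l i := lin (row i B) f.
have lH i : equivariant H (l i) by apply: lin_equivariant.
have [W [WH Wi WU]] := cup_product_cocycles pres sH lH UH lU cts ineq.
set H' := joint_ker H l in WH Wi.
have lvl' : level (N * p ^ d) H'.
  by rewrite /H' /l -(eq_in_joint_ker B ff0); apply: f0lvl.
have sH' : subgroup H' by apply: joint_ker_subgroup => // i; apply: equivariant_hom.
have gP (v : 'rV['F_p]_d) : exists2 g, H g & forall i, l i g = v 0%R i.
  by have [g [Hg gv _]] := lU (fun i => v 0%R i) (fun=> 0%R); exists g.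
pose g v := s2val (cid2 (gP v)).
have Hg v : H (g v) by rewrite /g; case: cid2.
have lg v i : l i (g v) = v 0%R i by rewrite /g; case: cid2.
pose E1 := [seq (g v * e.1, e.2) | e <- E, v <- enum {: 'rV['F_p]_d}].
have sizeE1 : size E1 = (size E * p ^ d)%N.
  by rewrite size_allpairs -cardE card_mx mul1n card_Fp.
have suppE1 : supported H' W E1.
  move=> k x i Wkx.
  have [m Um] : exists m, U m (k * b x) <> U m k.
    by apply/not_existsP => Uk; apply: Wkx; apply: WU => m; apply: contrapT.
  have [e eE [ex He]] := supp k x m Um.
  pose v := (\row_i l i (k * e.1^-1)%g)%R.
  exists (g v * e.1, e.2); first by apply/allpairsP; exists (e, v); rewrite mem_enum.
  split=> //=; rewrite invgM mulgA; split.
    by apply: (sgM sH) => //; apply: (sgV sH).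
  move=> j; have lj := equivariant_hom (lH j).
  rewrite lj ?(hom_onV sH lj) ?lg ?mxE ?subrr //; exact: (sgV sH).
pose val_at (e : K * 'I_n) : 'rV['F_p]_u.+1 :=
  (\row_i (W i (e.1 * b e.2)%g - W i e.1))%R.
(* The value [v] is taken on at least a [1 / p ^ u.+1] part of the support. *)
have [v vE] := pigeonhole val_at E1 0%R.
have [//|B2 fB2 B2v] := @homogeneous_solutions _ unit u.+1 u
    (fun _ i => v 0%R i) [:: tt].
pose U' i := lin (row i B2) W.
exists d, H', U', [seq e <- E1 | val_at e != v]; split.
  split=> //; first by move=> m; apply: lin_equivariant.
    exact: indep_row_free.
  move=> k x m U'kx.
  have U'W h y : U' m (h * b y) = (U' m h + \sum_j B2 m j * val_at (h, y) 0%R j)%R.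
    rewrite /U' /lin -big_split; apply: eq_bigr => j _ /=.
    by rewrite !mxE -mulrDr addrC subrK.
  have [i Wi'] : exists i, W i (k * b x) <> W i k.
    apply/not_existsP => Wk; apply: U'kx; rewrite U'W big1 ?addr0 // => j _.
    by rewrite mxE /= (contrapT (Wk j)) subrr mulr0.
  have [e eE [ex He]] := suppE1 k x i Wi'.
  exists e => //; rewrite mem_filter eE andbT; apply/eqP => val_e.
  apply: U'kx; pose h := k * e.1^-1.
  have U'H : equivariant H' (U' m) by apply: lin_equivariant.
  have -> : k = h * e.1 by rewrite mulgVK.
  rewrite -[h * e.1 * _]mulgA (U'H h _ He) (U'H h _ He) U'W -ex.
  by rewrite -surjective_pairing val_e (B2v tt) ?inE // addr0.
rewrite card_mx mul1n card_Fp // in vE.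
rewrite size_filter -sizeE1.
have := count_predC (fun e => val_at e == v) E1.
set x := count _ _ in vE *; set y := count (predC _) _.
move=> xyE; rewrite -xyE in vE *.
have P0 : (0 < p ^ u.+1)%N by rewrite expn_gt0 prime_gt0.
move: vE; rewrite -(prednK P0) /= mulSn leq_add2l => yx.
by rewrite mulnS mulnDr [X in _ <= _ + X]mulnC leq_add2r.
Qed.

End Descent.

Lemma geometric_decay a m : (0 < m)%N ->
  exists j, (a * m ^ j <= m.+1 ^ j)%N.
Proof.
move=> m0; have bernoulli j : (m ^ j * (m + j) <= m * m.+1 ^ j)%N.
  elim: j => [|j IH]; first by rewrite !expn0 mul1n muln1 addn0.
  apply: (@leq_trans ((m ^ j * (m + j)) * m.+1)); last first.
    by rewrite expnSr mulnA leq_mul2r IH orbT.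
  rewrite expnSr -!mulnA leq_mul2l; apply/orP; right.
  rewrite addnS mulnS [((m + j) * m.+1)%N]mulnS [(m * (m + j))%N]mulnC.
  by rewrite leq_add2r leq_addr.
exists (a * m)%N; rewrite -(leq_pmul2l m0).
apply: leq_trans (bernoulli _); rewrite mulnA [(m * a)%N]mulnC mulnC.
by rewrite leq_mul2l leq_addl orbT.
Qed.

Section Iterate.
Variables (p : nat) (p_pr : prime p) (n : nat) (K F : groupType).
Variables (b : 'I_n -> K) (rels : seq (seq ('I_n * bool))).
Hypothesis pres : presents b rels.
Variables (K0 : K -> Prop) (sim : (F -> Prop) -> K -> F -> Prop).
Hypotheses (K0n : p_normal p K0) (app : approximation p K0 sim).
Variables (X : Type) (c : X -> F) (x1 x2 : X).
Hypotheses (fc : free_on c) (x12 : x1 <> x2).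
Variable cs : seq K.
Hypothesis cov0 : covers K0 cs.

Lemma deep_level j : exists2 N, (j < N)%N & exists H, level p sim N H.
Proof.
elim: j => [|j [N jN [H lH]]]; first by exists 1%N => //; exists K0; apply: level_base app.
have [f [_ _ /(_ N 1%:M%R) lf]] := level_homs p_pr K0n app fc x12 lH.
exists (N * p ^ N)%N; last by eexists; apply: lf; rewrite row_free_unit unitmx1.
have N0 : (0 < N)%N by apply: leq_trans jN.
apply: (leq_ltn_trans jN); rewrite -{1}(muln1 N) ltn_pmul2l //.
by rewrite -{1}(expn0 p) ltn_exp2l // prime_gt1.
Qed.

Lemma initial_stage u N0 : exists N H (U : 'I_u -> K -> 'F_p) E,
  [/\ stage b sim N H U E, (N0 <= N)%N & (size E <= size cs * n * N)%N].
Proof.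
have [N Nu [H lH]] := deep_level (N0 + u).
have sH := level_subgroup K0n app lH.
have [f0 [f0H f0i _]] := level_homs p_pr K0n app fc x12 lH.
have [f [fH ff0]] := equivariant_extensions sH f0H.
have [|B fB _] := @homogeneous_solutions 'F_p unit N u (fun _ _ => 0%R) [::].
  by apply: leq_trans (ltnW Nu); apply: leq_addl.
have [ts sts cts] := level_covers K0n app cov0 lH.
exists N, H, (fun i => lin (row i B) f), [seq (t, x) | t <- ts, x <- enum 'I_n].
split.
- split=> //; first by move=> m; apply: lin_equivariant.
    by apply: indep_row_free => //; apply: eq_in_indep f0i.
  move=> k x m _; have [t tts kt] := cts k.
  by exists (t, x) => //; apply/allpairsP; exists (t, x); rewrite mem_enum.
- by apply: leq_trans (ltnW Nu); apply: leq_addr.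
by rewrite size_allpairs size_enum_ord sts mulnAC.
Qed.

(** Each step of the descent multiplies the ratio of [size E] to [N] by at most
    [1 - 1 / p ^ u.+1]. The bound on [u] makes the cup products outnumber the
    relators of a level, uniformly in the level. *)
Lemma small_support u M N0 : (size cs * size rels < u)%N ->
  exists N H (U : 'I_u -> K -> 'F_p) E,
  [/\ stage b sim N H U E, (N0 <= N)%N & (M * size E <= N)%N].
Proof.
move=> qmu; pose P := (p ^ u.+1)%N; pose s := (size cs * n)%N.
have P1 : (1 < P)%N by rewrite -{1}(expn0 p) ltn_exp2l // prime_gt1.
have main j : exists N H (U : 'I_u -> K -> 'F_p) E,
    [/\ stage b sim N H U E, (N0 + (u * u + u.+1) <= N)%N &
      (size E * P ^ j <= P.-1 ^ j * (s * N))%N].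
  elim: j => [|j [N [H [U [E [st N0N sE]]]]]].
    have [N [H [U [E [st N0N sE]]]]] := initial_stage u (N0 + (u * u + u.+1)).
    by exists N, H, U, E; split=> //; rewrite !expn0 muln1 mul1n.
  have uN : (u * u + u.+1 <= N)%N by apply: leq_trans N0N; apply: leq_addl.
  have uN' : (u <= N)%N.
    by apply: leq_trans uN; rewrite addnS -addSn; apply: leq_addl.
  have [|d [H' [U' [E' [st' sE']]]]] := stage_step p_pr pres K0n app fc x12 cov0 st uN'.
    rewrite mulnBl leq_subRL; last by rewrite leq_mul2r uN' orbT.
    apply: (@leq_trans (N * (size cs * size rels).+1)); last first.
      by rewrite leq_mul2l qmu orbT.
    by rewrite addnCA mulnS mulnAC [X in (X + _)%N]mulnC addnC leq_add2r.
  exists (N * p ^ d)%N, H', U', E'; split=> //.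
    apply: (leq_trans N0N); rewrite -{1}(muln1 N) leq_mul2l.
    by rewrite expn_gt0 prime_gt0 // orbT.
  rewrite !expnSr; set A := P.-1 in sE sE' *.
  have -> : (size E' * (P ^ j * P) = size E' * P * P ^ j)%N.
    by rewrite !mulnA mulnAC.
  apply: (@leq_trans (A * (size E * p ^ d) * P ^ j)).
    by rewrite leq_mul2r sE' orbT.
  have -> : (A * (size E * p ^ d) * P ^ j = size E * P ^ j * (A * p ^ d))%N.
    by rewrite !mulnA [LHS](ACl (2*4*1*3)).
  have -> : (A ^ j * A * (s * (N * p ^ d)) = A ^ j * (s * N) * (A * p ^ d))%N.
    by rewrite !mulnA [LHS](ACl (1*3*4*5*2*6)).
  by rewrite leq_mul2r sE orbT.
have P10 : (0 < P.-1)%N by rewrite -ltnS prednK // ltnW.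
have [j jP] := geometric_decay (M * s) P10.
rewrite prednK in jP; last exact: ltnW.
have [N [H [U [E [st N0N sE]]]]] := main j.
exists N, H, U, E; split=> //; first by apply: leq_trans N0N; apply: leq_addr.
have Pj : (0 < P ^ j)%N by rewrite expn_gt0 ltnW.
rewrite -(leq_pmul2r Pj) -mulnA.
apply: (@leq_trans (M * (P.-1 ^ j * (s * N)))); first by rewrite leq_mul2l sE orbT.
have -> : (M * (P.-1 ^ j * (s * N)) = N * (M * s * P.-1 ^ j))%N.
  by rewrite !mulnA [LHS](ACl (5*1*3*4*2)).
by rewrite leq_mul2l jP orbT.
Qed.

End Iterate.

(** * Noncommuting elements of free groups *)

Lemma free_nonabelian_basis (X : Type) (F : groupType) (b : X -> F) :
  free_on b -> (exists x y : F, x * y <> y * x) -> exists x1 x2 : X, x1 <> x2.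
Proof.
move=> fb [f [g fg]]; apply: contrapT => X1; apply: fg.
have gb := free_on_generates fb.
have {}X1 (x y : X) : x = y by apply: contrapT => xy; apply: X1; exists x, y.
have cb x f' : commute (b x) f'.
  elim/(generates_ind gb): f' => [|f' y IH|f' y IH]; first exact: commute1.
    by apply: commuteM => //; rewrite (X1 y x).
  by apply: commuteM => //; apply: commuteV; rewrite (X1 y x).
elim/(generates_ind gb): g => [|g y IH|g y IH]; first exact: commute1.
  exact: commuteM IH (commute_sym (cb y f)).
exact: commuteM IH (commuteV (commute_sym (cb y f))).
Qed.

(** Two elements of a basis act on [Z * Z] by a translation of the first
    coordinate and by a shear; their positive powers then do not commute. *)
Section NoncommutingPowers.
Local Open Scope ring_scope.

Let shiftK (u : int * int) : (u.1 + 1 - 1, u.2) = u.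
Proof. by case: u => x y; rewrite /= addrK. Qed.
Let shiftVK (u : int * int) : (u.1 - 1 + 1, u.2) = u.
Proof. by case: u => x y; rewrite /= subrK. Qed.
Let shearK (u : int * int) : (u.1, u.2 + u.1 - u.1) = u.
Proof. by case: u => x y; rewrite /= addrK. Qed.
Let shearVK (u : int * int) : (u.1, u.2 - u.1 + u.1) = u.
Proof. by case: u => x y; rewrite /= subrK. Qed.

Let shift : bij (int * int) :=
  @Bij _ (fun u => (u.1 + 1, u.2)) (fun u => (u.1 - 1, u.2)) shiftK shiftVK.
Let shear : bij (int * int) :=
  @Bij _ (fun u => (u.1, u.2 + u.1)) (fun u => (u.1, u.2 - u.1)) shearK shearVK.

Let shiftX n u : (shift ^+ n)%g u = (u.1 + n%:R, u.2).
Proof.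
elim: n u => [|n IH] u; first by rewrite addr0; case: u.
by rewrite expgS bijM IH /= mulrS addrA.
Qed.

Let shearX n u : (shear ^+ n)%g u = (u.1, u.2 + u.1 *+ n).
Proof.
elim: n u => [|n IH] u; first by rewrite mulr0n addr0; case: u.
by rewrite expgS bijM IH /= mulrS addrA.
Qed.

Lemma free_powers_noncommuting (X : Type) (F : groupType) (b : X -> F) x1 x2 m n :
  free_on b -> x1 <> x2 -> (0 < m)%N -> (0 < n)%N ->
  (b x1 ^+ m * b x2 ^+ n <> b x2 ^+ n * b x1 ^+ m)%g.
Proof.
move=> fb x12 m0 n0 e.
pose h x : bij (int * int) :=
  if pselect (x = x1) then shift else if pselect (x = x2) then shear else 1%g.
have [f [fh _]] := fb _ h.
have h1 : h x1 = shift by rewrite /h; case: pselect.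
have h2 : h x2 = shear.
  rewrite /h; case: pselect => [e21|n21]; first by case: (x12 (esym e21)).
  by case: pselect.
have := congr1 f e; rewrite !gmulfM !gmulfXn !fh h1 h2 => e'.
have : ((shift ^+ m * shear ^+ n)%g (0, 0)).2
    = ((shear ^+ n * shift ^+ m)%g (0, 0)).2 by rewrite e'.
rewrite !bijM !shiftX !shearX /= !add0r mul0rn.
rewrite -mulrnA => /eqP; rewrite Num.Theory.pnatr_eq0 muln_eq0.
by case/orP=> /eqP e0; move: m0 n0; rewrite e0.
Qed.

End NoncommutingPowers.

(** With at most one basis element the group would be cyclic, and [t0] and [t1]
    proportional. *)
Lemma free_two_basis_elements p (I : groupType) (Y : Type) (e : Y -> I)
    (t0 t1 : I -> 'F_p) (z0 z1 : I) : free_on e ->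
  {morph t0 : x y / (x * y)%g >-> (x + y)%R} ->
  {morph t1 : x y / (x * y)%g >-> (x + y)%R} ->
  prime p -> t0 z0 <> 0%R -> t1 z0 = 0%R -> t0 z1 = 0%R -> t1 z1 <> 0%R ->
  exists y0 y1 : Y, y0 <> y1.
Proof.
move=> fe t0M t1M p_pr z00 z01 z10 z11; apply: contrapT => Y1.
have {}Y1 (x y : Y) : x = y by apply: contrapT => xy; apply: Y1; exists x, y.
have ge := free_on_generates fe.
have t01 : t0 1 = 0%R by apply: (addrI (t0 1)); rewrite -t0M mulg1 addr0.
have t11 : t1 1 = 0%R by apply: (addrI (t1 1)); rewrite -t1M mulg1 addr0.
have t0V x : t0 x^-1 = (- t0 x)%R.
  by apply: (addrI (t0 x)); rewrite -t0M mulgV t01 subrr.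
have t1V x : t1 x^-1 = (- t1 x)%R.
  by apply: (addrI (t1 x)); rewrite -t1M mulgV t11 subrr.
have [[y0 _]|Y0] := EM (exists y : Y, True); last first.
  apply: z00; elim/(generates_ind ge): z0 {z01} => // k x; case: Y0; by exists x.
have prop f : (t1 (e y0) * t0 f = t0 (e y0) * t1 f)%R.
  elim/(generates_ind ge): f => [|f y IH|f y IH]; first by rewrite t01 t11 !mulr0.
    by rewrite t0M t1M !mulrDr IH (Y1 y y0) [(t1 _ * t0 _)%R]mulrC.
  by rewrite t0M t1M t0V t1V !mulrDr IH (Y1 y y0) !mulrN [(t1 _ * t0 _)%R]mulrC.
have := prop z0; rewrite z01 mulr0 => /eqP; rewrite mulf_eq0.
case/orP=> /eqP // e1.
have := prop z1; rewrite z10 mulr0 => /esym/eqP; rewrite mulf_eq0.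
case/orP=> /eqP // e0.
by apply: z00; elim/(generates_ind ge): z0 {z01} => // k x IH;
  rewrite t0M IH ?t0V (Y1 x y0) e0 ?oppr0 addr0.
Qed.

(** * Separated cocycles and free quotients *)

Lemma cross_shift (R : comPzRingType) (q u u' v v' t : R) :
  (q + (u - u') * (v + v') - t + v * u' = q - t + v * u + (u - u') * v')%R.
Proof.
rewrite mulrDr [(_ * v)%R]mulrBl ![(v * _)%R]mulrC !addrA.
by rewrite [LHS](ACl (1*5*2*4*6*3)) /= addrK.
Qed.

Lemma addgrpX (A : zmodType) (x : addgrp A) n : x ^+ n = (x *+ n)%R :> A.
Proof. by elim: n => [|n IH] //; rewrite expgS addgrpM IH mulrS. Qed.

Section PathEdges.
Variables (X : eqType) (K : groupType) (b : X -> K).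

Fixpoint path_edges (k : K) (w : seq (X * bool)) : seq (K * X) :=
  if w is l :: w' then
    (if l.2 then k else k * (b l.1)^-1, l.1) :: path_edges (k * letter_val b l) w'
  else [::].

Lemma path_edges_shift h k w :
  path_edges (h * k) w = [seq (h * e.1, e.2) | e <- path_edges k w].
Proof.
elim: w k => [|[x s] w IH] k //=; rewrite -[h * k * letter_val _ _]mulgA IH; congr (_ :: _).
by case: s; rewrite ?mulgA.
Qed.

Variables (A : groupType) (c : K -> X -> A).

Lemma path_prod_trivial k w :
  {in path_edges k w, forall e, c e.1 e.2 = 1} -> path_prod b c k w = 1.
Proof.
elim: w k => [|[x s] w IH] k //= ce.
rewrite IH => [|e ew]; last by apply: ce; rewrite inE ew orbT.
by have := ce _ (mem_head _ _); rewrite mulg1 /letter_step; case: s {ce} => /= ->;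
  rewrite ?invg1.
Qed.

Lemma path_prod_telescope (f : K -> A) k w :
  {in path_edges k w, forall e, c e.1 e.2 = f e.1 * (f (e.1 * b e.2))^-1} ->
  path_prod b c k w = f k * (f (k * word_val b w))^-1.
Proof.
elim: w k => [|[x s] w IH] k /= ce; first by rewrite mulg1 mulgV.
rewrite IH => [|e ew]; last by apply: ce; rewrite inE ew orbT.
have := ce _ (mem_head _ _); rewrite /letter_step /letter_val; case: s {ce} => /= ->.
  by rewrite !mulgA mulgVK.
by rewrite invgM invgK mulgVK !mulgA mulgVK.
Qed.

End PathEdges.

Section Separation.
Variables (p : nat) (p_pr : prime p) (X : eqType) (K : groupType) (b : X -> K).
Variable rels : seq (seq (X * bool)).
Hypothesis pres : presents b rels.
Variables (H : K -> Prop) (U : bool -> K -> 'F_p) (V : K -> 'F_p).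
Hypotheses (sH : subgroup H) (oH : p_open p H).
Hypotheses (UH : forall i, equivariant H (U i)) (VH : equivariant H V).
Variables (g : K) (h : bool -> K).
Hypotheses (Hg : H g) (Hh : forall i, H (h i)).
Hypotheses (Vg : V g <> 0%R) (Vh : forall i, V (h i) = 0%R)
  (Uh : forall i j, U i (h j) = (i == j)%:R%R).
Hypothesis separated : forall k i, i < size rels ->
  {in path_edges b k (nth [::] rels i),
    forall e, forall j, U j (e.1 * b e.2) = U j e.1} \/
  {in path_edges b k (nth [::] rels i), forall e, V (e.1 * b e.2) = V e.1}.
Variables (F : groupType) (T : Type) (c : T -> F) (x0 x1 : T).
Hypotheses (fc : free_on c) (x01 : x0 <> x1).

Let gb : generates b. Proof. by case: pres. Qed.

Let H' := joint_ker H (fun o => if o is Some i then U i else V).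

(** Consider the homomorphism to the free product of [(Z/p)^2] and [Z/p] that
    reads the increments of the [U i] and of [V] as letters of the two factors;
    it respects the relators because none of them involves both factors. The
    kernel of the projection to the direct product is free on commutators
    labelled by pairs of nontrivial elements, and [C] is the resulting cochain
    followed by the map that sends the commutator labelled by the values of the
    [U i] at [k] and by [j] to [lab k j]. Its sum vanishes round a relator along
    which the [U i] are constant, where it is trivial, and round one along which
    [V] is constant, where it telescopes. *)
Let lab (k : K) (j : 'F_p) : F :=
  c x0 ^+ (U false k * j)%R * c x1 ^+ (U true k * j)%R.

Let C (k : K) (x : X) : F := lab k (V k) * (lab (k * b x) (V k))^-1.

Let C_rel k i : i < size rels -> path_prod b C k (nth [::] rels i) = 1.
Proof.
move=> ilt; have [_ rel1 _] := pres.
case: (separated k ilt) => const.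
  by apply: path_prod_trivial => -[k' x] /const /= Uk; rewrite /C /lab !Uk mulgV.
suff VkE : {in path_edges b k (nth [::] rels i), forall e, V e.1 = V k}.
  rewrite (@path_prod_telescope _ _ b _ C (lab ^~ (V k))) ?rel1 // ?mulg1 ?mulgV //.
  by move=> -[k' x] /VkE /= Vk'; rewrite /C Vk'.
suff gen w l : V l = V k ->
    {in path_edges b l w, forall e, V (e.1 * b e.2) = V e.1} ->
    {in path_edges b l w, forall e, V e.1 = V k} by exact: gen.
elim: w l => [|[x s] w IH] l lk //= lconst.
have lE := lconst _ (mem_head _ _).
have lV : V (l * letter_val b (x, s)) = V k.
  by rewrite -lk /letter_val; case: s lE {lconst} => /=; rewrite ?mulgVK => ->.
move=> e; rewrite inE => /orP[/eqP->|] /=.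
  by case: s lE {lV lconst} => //=; rewrite mulgVK => <-.
by apply: IH => // e' ew; apply: lconst; rewrite inE ew orbT.
Qed.
Let UHom i : hom_on H (U i) := equivariant_hom (UH i).
Let VHom : hom_on H V := equivariant_hom VH.

Let UVHom o : hom_on H (if o is Some i then U i else V).
Proof. by case: o => [i|]; [apply: UHom | apply: VHom]. Qed.

Let sH' : subgroup H' := joint_ker_subgroup sH UVHom.
Let oH' : p_open p H' := joint_ker_open p_pr sH UVHom oH.

Let H'E k : H' k <-> [/\ H k, forall i, U i k = 0%R & V k = 0%R].
Proof.
split=> [[Hk k0]|[Hk Uk Vk]]; last by split=> // -[].
by split=> // [i|]; [apply: (k0 (Some i)) | apply: (k0 None)].
Qed.

Let C_shift k' k x : H' k' -> C (k' * k) x = C k x.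
Proof.
move=> /H'E[Hk' Uk' Vk']; rewrite /C /lab -[k' * k * b x]mulgA.
by rewrite !(UH _ _ Hk') !(VH _ Hk') !Uk' Vk' !add0r.
Qed.

Let theta_ex (i : bool) : exists t : {ghom F -> addgrp 'F_p},
  forall k j, t (lab k j) = (U i k * j)%R.
Proof.
pose x i := if i then x1 else x0.
pose one_at y : addgrp 'F_p := if pselect (y = x i) then 1%R : 'F_p else 0%R.
have [t [tc _]] := fc one_at.
exists t => k j; rewrite /lab gmulfM !gmulfXn !tc !addgrpX addgrpM /one_at /x.
case: i {tc one_at}; case: pselect => e0; case: pselect => e1 //.
- by rewrite mul0rn add0r natr_Zp.
- by case: (x01 (esym e1)).
- by rewrite mul0rn addr0 natr_Zp.
Qed.

(** The primitive [W] of [C] is a homomorphism on [H']. The commutators [z i] of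
    [g] with the [h i] lie in [H'] and show that the two homomorphisms from [F]
    to [F_p] that count the letters [c x0] and [c x1] are independent on the
    image of [H'], which is free by Nielsen-Schreier and therefore not cyclic.
    Powers of two basis elements of this image come from a normal subgroup of
    [K] of [p]-power index and still do not commute. *)
Theorem separated_p_large : p_large p K.
Proof.
have [_ _ int] := pres.
have [W iW] := int F C C_rel.
have WH k' k : H' k' -> W (k' * k) = W k' * W k.
  by move=> Hk'; apply: (primitive_shift gb iW) => l x; apply: C_shift.
pose th i := sval (cid (theta_ex i)).
have thE i k j : th i (lab k j) = (U i k * j)%R by rewrite /th; case: cid.
pose t i (k : K) : 'F_p := th i (W k).
have tE i : primitive b
    (fun k x => ((U i k - U i (k * b x)%g) * V k)%R : addgrp 'F_p) (t i).
  split; first by rewrite /t iW.1 gmulf1.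
  move=> k x; rewrite /t iW.2 gmulfM; congr (_ * _).
  by rewrite /C gmulfM gmulfV !thE addgrpM addgrpV mulrBl.
have t1 i : t i 1 = 0%R by have [-> _] := tE i.
have U1 i : U i 1 = 0%R := hom_on1 sH (UHom i).
have t_shift i a k : H a -> t i (a * k) = (t i a + t i k - V a * U i k)%R.
  move=> Ha; have tE2 : primitive b
      (fun k x => ((U i k - U i (k * b x)%g) * V k)%R : addgrp 'F_p)
      (fun k => (t i (a * k)%g - t i a + V a * U i k)%R).
    split; first by rewrite mulg1 subrr U1 mulr0 addr0.
    move=> k' x; rewrite mulgA (tE i).2 !addgrpM -mulgA.
    rewrite (UH i _ Ha) (UH i _ Ha) (VH _ Ha) opprD addrACA subrr add0r.
    exact: cross_shift.
  rewrite -(primitive_eq gb tE2 (tE i) k) addrA addrK.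
  by rewrite addrC subrK.
have UV_comm x y : H x -> H y -> H' (x * y * (y * x)^-1).
  move=> Hx Hy; have Hxy := sgM sH Hx Hy; have Hyx := sgM sH Hy Hx.
  have hom0 f : hom_on H f -> f (x * y * (y * x)^-1) = 0%R.
    move=> fH; rewrite fH ?(hom_onV sH fH) ?fH ?[(f x + _)%R]addrC ?subrr //.
    exact: (sgV sH).
  apply/H'E; split=> [|i|]; last exact: hom0.
    by apply: (sgM sH) => //; apply: (sgV sH).
  exact: hom0.
pose z i := g * h i * (h i * g)^-1.
have H'z i : H' (z i) by apply: UV_comm.
have tz i j : t j (z i) = (- V g * (j == i)%:R)%R.
  have := t_shift j g (h i) Hg; rewrite Uh -[g * h i](mulgVK (h i * g)).
  rewrite -/(z i) t_shift; last by case/H'E: (H'z i).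
  have [_ _ ->] := (H'E _).1 (H'z i).
  rewrite mul0r subr0 t_shift // Vh mul0r subr0 [in RHS](addrC (t j g)).
  by rewrite [RHS]addrC mulNr => /addIr.
pose I (f : F) := exists2 k, H' k & f = W k.
have sI : subgroup I.
  split.
  - by exists 1; [exact: (sg1 sH') | rewrite iW.1].
  - move=> _ _ [k Hk ->] [l Hl ->]; exists (k * l); last by rewrite WH.
    exact: (sgM sH').
  move=> _ [k Hk ->]; exists k^-1; first exact: (sgV sH').
  by apply: (mulgI (W k)); rewrite -WH // !mulgV iW.1.
have [Y [e fe]] : free_group (sg_type sI).
  by apply: nielsen_schreier; exists T, c.
have Iz i : I (W (z i)) by exists (z i).
pose ti i (f : sg_type sI) : 'F_p := th i (val f).
have tiM i : {morph ti i : x y / (x * y)%g >-> (x + y)%R}.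
  by move=> x y; rewrite /ti sg_valM gmulfM.
have tiz i j : ti j (sg_elt sI (Iz i)) = (- V g * (j == i)%:R)%R.
  by rewrite /ti sg_eltK -tz.
have Vg' : (- V g)%R <> 0%R.
  by move/eqP; rewrite oppr_eq0 => /eqP.
have [y0 [y1 y01]] : exists y0 y1 : Y, y0 <> y1.
  apply: (free_two_basis_elements fe (tiM false) (tiM true) p_pr
    (z0 := sg_elt sI (Iz false)) (z1 := sg_elt sI (Iz true)));
  by rewrite tiz ?mulr1 ?mulr0.
have WX k n : H' k -> W (k ^+ n) = W k ^+ n.
  move=> Hk; elim: n => [|n IH]; first by rewrite !expg0 iW.1.
  by rewrite !expgS WH // IH.
have [N nN NH] := oH'.
have preim y : exists k, H' k /\ val (e y) = W k.
  by have [k Hk ek] := sg_typeP (e y); exists k.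
have [k0 [Hk0 ek0]] := preim y0; have [k1 [Hk1 ek1]] := preim y1.
have [j0 Nk0] : exists j, N (k0 ^+ (p ^ j)%N) by apply: (p_normal_tors nN).
have [j1 Nk1] : exists j, N (k1 ^+ (p ^ j)%N) by apply: (p_normal_tors nN).
have pj j : (0 < p ^ j)%N by rewrite expn_gt0 prime_gt0.
have ncomm := free_powers_noncommuting fe y01 (pj j0) (pj j1).
pose J (f : F) := exists2 k, N k & f = W k.
have sJ : subgroup J.
  split.
  - by exists 1; [exact: (sg1 nN) | rewrite iW.1].
  - move=> _ _ [k Nk ->] [l Nl ->]; exists (k * l); last by rewrite WH //; apply: NH.
    exact: (sgM nN).
  move=> _ [k Nk ->]; exists k^-1; first exact: (sgV nN).
  by apply: (mulgI (W k)); rewrite -WH ?mulgV ?iW.1 //; apply: NH.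
pose NN := sval (p_index p_pr nN).
have NNP x : reflect (N x) (x \in NN) by apply: p_indexP.
have JW (u : subg_of NN) : J (W (val u)).
  by exists (val u) => //; apply/NNP; apply: (valP u).
have [f fE] : exists f : {ghom subg_of NN -> sg_type sJ},
    f =1 fun u => sg_elt sJ (JW u).
  apply: ghom_exists => u v; apply: val_inj.
  have vM : val (u * v) = val u * val v by exact: gmulfM.
  transitivity (W (val (u * v))); first exact: sg_eltK.
  rewrite vM (sg_valM (sg_elt sJ (JW u)) (sg_elt sJ (JW v))).
  rewrite (sg_eltK sJ (JW u)) (sg_eltK sJ (JW v)) WH //.
  by apply: NH; apply/NNP; exact: (valP u).
exists NN, (sg_type sJ), f; split.
- exact: (svalP (p_index p_pr nN)).
- by apply: nielsen_schreier; exists T, c.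
- have J0 : J (W (k0 ^+ (p ^ j0)%N)) by eexists; first exact: Nk0.
  have J1 : J (W (k1 ^+ (p ^ j1)%N)) by eexists; first exact: Nk1.
  exists (sg_elt sJ J0), (sg_elt sJ J1) => /(congr1 val).
  rewrite !sg_valM !sg_eltK !WX // -ek0 -ek1 => comm.
  have valX y n : val (e y ^+ n) = val (e y) ^+ n by exact: gmulfXn.
  by apply: ncomm; apply: val_inj; rewrite !sg_valM !valX.
move=> v _; have [k Nk vk] := sg_typeP v.
have kNN : k \in NN by apply/NNP.
exists (Sub k kNN) => //; rewrite fE; apply: val_inj.
by rewrite sg_eltK vk SubK.
Qed.

End Separation.

(** * Transfer of p-largeness *)

(** Deep in the tower the support of the [U m] is so small that some cocycle [V]
    vanishes on all edges that share a relator with it, and also at points dual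
    to the [U m], which makes [V] independent from them. *)
Theorem approximation_p_large p (K F : groupType) (K0 : K -> Prop)
    (sim : (F -> Prop) -> K -> F -> Prop) : prime p ->
  finitely_presented K -> p_normal p K0 -> approximation p K0 sim ->
  free_group F -> (exists x y : F, x * y <> y * x) -> p_large p K.
Proof.
move=> p_pr /finitely_presented_presents[n [b [rels pres]]] K0n app.
move=> [X [c fc]] /(free_nonabelian_basis fc)[x1 [x2 x12]].
have [cs cov0] := p_normal_covers K0n.
pose u := (size cs * size rels).+2.
(* Their translates are all the pairs of edges traversed by one relator. *)
pose pairs := flatten
  [seq [seq (y, y') | y <- path_edges b 1 r, y' <- path_edges b 1 r] | r <- rels].
have [N [H [U [E [st N0N sE]]]]] := small_support p_pr pres K0n app fc x12 cov0
  (2 * size pairs) (2 * u.+1) (leqnSn (size cs * size rels).+1).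
case: st => lvl UH Ui supp.
have sH := level_subgroup K0n app lvl.
have oH := level_open K0n app lvl.
have [f0 [f0H f0i _]] := level_homs p_pr K0n app fc x12 lvl.
have [f [fH ff0]] := equivariant_extensions sH f0H.
have fi : indep H f := eq_in_indep ff0 f0i.
have hP m := indep_surj sH (fun i => equivariant_hom (UH i)) Ui
  (fun i => (i == m)%:R%R).
pose h m := s2val (cid2 (hP m)).
have Hh m : H (h m) by rewrite /h; case: cid2.
have Uh i m : U i (h m) = (i == m)%:R%R by rewrite /h; case: cid2.
pose near := [seq (e.1 * yy.1.1^-1 * yy.2.1, yy.2.2) | e <- E, yy <- pairs].
pose phi (t : 'I_u + K * 'I_n) j : 'F_p := match t with
  | inl m => f j (h m)
  | inr e => (f j (e.1 * b e.2)%g - f j e.1)%R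
  end.
have [|B fB Bphi] := @homogeneous_solutions _ _ N 1 phi
    ([seq inl m | m <- enum 'I_u] ++ [seq inr e | e <- near]).
  rewrite size_cat !size_map size_allpairs addn1 -enumT size_enum_ord.
  rewrite -(@leq_pmul2l 2) // -addSn mulnDr [(2 * N)%N]mul2n -addnn.
  by apply: leq_add => //; rewrite [(size E * _)%N]mulnC mulnA.
pose V := lin (row 0%R B) f.
have VH : equivariant H V by apply: lin_equivariant.
have Vphi t : t \in ([seq inl m | m <- enum 'I_u] ++ [seq inr e | e <- near]) ->
    (\sum_j row 0%R B 0%R j * phi t j = 0)%R.
  by move=> /(Bphi t 0%R) e0; rewrite -[RHS]e0; apply: eq_bigr => j _; rewrite mxE.
have Vh m : V (h m) = 0%R.
  by apply: (Vphi (inl m)); rewrite mem_cat map_f ?mem_enum.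
have Vnear e : e \in near -> V (e.1 * b e.2) = V e.1.
  move=> enear; apply/eqP; rewrite -subr_eq0 -sumrB; apply/eqP.
  rewrite -[RHS](Vphi (inr e)); last first.
    by rewrite mem_cat; apply/orP; right; apply: map_f.
  by apply: eq_bigr => j _; rewrite mulrBr.
have [g0 [Hg0 Vg0]] : exists g0, H g0 /\ V g0 <> 0%R.
  apply: contrapT => V0; have : (const_mx 1 : 'rV['F_p]_1)%R = 0%R.
    apply: (indep_row_free fB fi) => k Hk.
    rewrite /lin big_ord1 mxE mul1r; apply: contrapT => Vk.
    by apply: V0; exists k.
  by move/rowP/(_ 0%R)/eqP; rewrite !mxE oner_eq0.
pose idx (i : bool) : 'I_u := if i then lift ord0 ord0 else ord0.
have idxE i j : (idx i == idx j) = (i == j) by case: i; case: j.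
apply: (separated_p_large p_pr pres sH oH (U := fun i => U (idx i)) (V := V)
  (g := g0) (h := fun i => h (idx i)) _ VH Hg0 _ Vg0 _ _ _ fc x12) => //.
  by move=> i j; rewrite Uh idxE.
move=> s i ilt.
have [[[e1 x] es Ue]|noU] := EM (exists2 e, e \in path_edges b s (nth [::] rels i)
    & exists j, U (idx j) (e.1 * b e.2) <> U (idx j) e.1); last first.
  left=> e es j; apply: contrapT => Uj; apply: noU; exists e => //; by exists j.
right=> e' e's.
move: es e's; rewrite -[s]mulg1 !path_edges_shift.
case/mapP=> -[y1 x'] yr [/= e1E xE]; subst x'.
case/mapP=> -[y' x'] y'r ->.
case: Ue => j /= /supp[[e0 x0] eE [/= x0E He]]; subst x0.
pose k := e1 * e0^-1.
have sE' : s = k * (e0 * y1^-1) by rewrite /k e1E !mulgA mulgVK mulgK.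
have nearE : (e0 * y1^-1 * y', x') \in near.
  apply/allpairsP; exists ((e0, x), ((y1, x), (y', x'))); split=> //.
  apply/flattenP; exists [seq (y, z) | y <- path_edges b 1 (nth [::] rels i),
    z <- path_edges b 1 (nth [::] rels i)].
    by apply/mapP; exists (nth [::] rels i) => //; apply: mem_nth.
  by apply/allpairsP; exists ((y1, x), (y', x')).
have VHk y : V (k * y) = (V k + V y)%R by apply: VH.
have /= nearV := Vnear _ nearE.
have -> : s * y' = k * (e0 * y1^-1 * y') by rewrite sE' -mulgA.
by rewrite -[k * _ * _]mulgA !VHk nearV.
Qed.

Lemma p_large_transfer (p : nat) (G K : groupType) : prime p ->
  finitely_presented K -> pro_completion_iso p G K -> p_large p G ->
  p_large p K.
Proof.
move=> p_pr K_fp iso [N [F [f [N_p Ffree Fnc fsurj]]]].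
have [psi [psiM psi_proj psi_surj]] := pro_completion_quotients p_pr iso.
apply: (approximation_p_large p_pr K_fp _ _ Ffree Fnc).
  exact: (base_kernel_p_normal p_pr psiM N_p).
exact: (psi_approximation p_pr psiM psi_proj psi_surj N_p fsurj).
Qed.

Theorem theorem1p2 (p : nat) (p_prime : prime p) (G K : groupType)
  (G_fp : finitely_presented G) (K_fp : finitely_presented K)
  (GK_iso : pro_completion_iso p G K) :
  p_large p G <-> p_large p K.
Proof.
split; first exact: p_large_transfer.
by apply: p_large_transfer => //; apply: pro_completion_iso_sym.
Qed.
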